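(* The category $\mathcal{W}$ is a gerbe with band $\mu_4$; that is, $\mathcal{W}$ is a groupoid in which every two objects are isomorphic, and $\mathrm{Mor}_{\mathcal{W}}(\mathfrak{E},\mathfrak{E})\simeq\mu_4$ (the group of fourth roots of unity) for every $\mathfrak{E}\in\mathcal{W}$.
   Context: Let $K$ be an unramified extension of $\mathbb{Q}_2$ of degree $d$, $\mathcal{O}_K$ its ring of integers, $\mathfrak{m}_K=2\mathcal{O}_K$, $k=\mathcal{O}_K/\mathfrak{m}_K=\mathbb{F}_{2^d}$, $R=\mathcal{O}_K/\mathfrak{m}_K^2$, $tr:R\to\mathbb{Z}/4$ the trace, $\psi(z)=e^{\frac{2\pi i}{4}tr(z)}$ for $z\in R$. Let $(\widetilde{V},\widetilde{\omega})$ be a free symplectic $R$-module of rank $2n$, $V=\widetilde{V}/2\widetilde{V}$. The form $2\widetilde{\omega}$ factors to a non-degenerate skew-symmetric form $\omega:V\times V\to R$. Fix a splitting $\widetilde{V}=\widetilde{L}_0\times\widetilde{M}_0$ into free Lagrangian submodules; put $\widetilde{\beta}((l_1,m_1),(l_2,m_2))=\widetilde{\omega}(l_1,m_2)$; $2\widetilde{\beta}$ factors to $\beta:V\times V\to R$. The Heisenberg group is $H(V)=V\times R$ with $(v_1,z_1)(v_2,z_2)=(v_1+v_2,z_1+z_2+\beta(v_1,v_2))$, with center $Z=\{0\}\times R$. $ELag(V)$ is the set of enhanced Lagrangians: group homomorphisms $\tau:L\to H(V)$ that are sections of $H(V)\to V$ over a Lagrangian subspace $L\subset V$; such $\tau$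 is denoted simply $L$. For $L\in ELag(V)$, $\mathcal{H}_L$ is the space of functions $f:H(V)\to\mathbb{C}$ with $f(z\tau(l)h)=\psi(z)f(h)$ for $z\in Z$, $l\in L$, with $H(V)$ acting by right translations (an irreducible representation). These form a bundle $\mathfrak{H}$ on $ELag(V)$ with fibers $\mathcal{H}_L$. An $H(V)^m$-vector bundle $\mathfrak{E}$ on $ELag(V)$ is a family of complex vector spaces $\mathfrak{E}_L$, $L\in ELag(V)$, each with an action of $H(V)^m$. A trivialization of it is a system of intertwining isomorphisms $E_{M,L}:\mathfrak{E}_L\to\mathfrak{E}_M$ for all $(M,L)\in ELag(V)^2$ with $E_{N,M}\circ E_{M,L}=E_{N,L}$. For $(M,L)$ in general position ($M+L=V$), $F_{M,L}:\mathcal{H}_L\to\mathcal{H}_M$ is $F_{M,L}[f](h)=\sum_{m\in M}f(\tau(m)h)$. The bundle $\mathfrak{H}^{\otimes4}$ carries the canonical trivialization $\{T_{M,L}\}$, the unique one with $T_{M,L}=\frac{(-1)^{dn}}{|M|^2}F_{M,L}^{\otimes4}$ for $(M,L)$ in general position. The category $\mathcal{W}$: objects are triples $(\mathfrak{E},\{E_{M,L}\},\varphi)$ with $\mathfrak{E}$ an $H(V)$-vector bundle, $\{E_{M,L}\}$ a trivialization of it, and $\varphi:\mathfrak{E}\to\mathfrak{H}$ an isomorphism of $H(V)$-vector bundles such that $\varphi^{\otimes4}:\mathfrak{E}^{\otimes4}\to\mathfrak{H}^{\otimes4}$ is an isomorphism of trivialized $H(V)^4$-vector bundles (i.e. is compatible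 with the trivializations $\{E_{M,L}^{\otimes4}\}$ and $\{T_{M,L}\}$). A morphism $\mathfrak{E}_1\to\mathfrak{E}_2$ is a morphism $f$ of trivialized $H(V)$-vector bundles (fiberwise intertwining and commuting with the trivializations) with $\varphi_2^{\otimes4}\circ f^{\otimes4}=\varphi_1^{\otimes4}$. A gerbe is a groupoid consisting of a single isomorphism class of objects; its band is the automorphism group of any of its objects. *)

(* Defs.v *)
From HB Require Import structures.
From mathcomp Require Import all_boot all_order all_algebra all_fingroup all_field.
From mathcomp Require Import mxpoly fraction complex.
From mathcomp Require Import boolp classical_sets functions reals trigo.
From mathcomp Require Import ring.

Set Implicit Arguments.
Unset Strict Implicit.
Unset Printing Implicit Defensive.

Import Order.TTheory GRing.Theory Num.Theory.
Local Open Scope ring_scope.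

(* 2-adic integers: the inverse limit of the rings Z/2^n, where x_n is the
   representative of the n-th component in [0, 2^n). *)
Record Z2 := MkZ2 {
  z2 :> nat -> nat;
  z2P : forall n, z2 n = (z2 n.+1 %% 2 ^ n)%N }.

HB.instance Definition _ := gen_eqMixin Z2.
HB.instance Definition _ := gen_choiceMixin Z2.

Section Z2ring.

Local Open Scope nat_scope.
Implicit Types x y z : Z2.

Lemma Z2_eq x y : z2 x =1 z2 y -> x = y.
Proof.
case: x y => [x xP] [y yP] /= /funext exy; move: yP; rewrite -exy => yP.
by congr MkZ2; apply: Prop_irrelevance.
Qed.

Lemma z2_mod x n : x n %% 2 ^ n = x n.
Proof. by rewrite [in RHS]z2P [x n]z2P modn_mod. Qed.

Lemma z2_le x m n : m <= n -> x n %% 2 ^ m = x m.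
Proof.
move=> /subnK <-; elim: (n - m) => [|i IHi]; first exact: z2_mod.
rewrite -[RHS]IHi [x (i + m)]z2P modn_dvdm //.
by rewrite dvdn_exp2l // leq_addl.
Qed.

Definition z2_of (f : nat -> nat)
  (fP : forall n, f n.+1 = f n %[mod 2 ^ n]) : Z2.
Proof.
exists (fun n => f n %% 2 ^ n) => n.
by rewrite modn_dvdm ?dvdn_exp2l // fP.
Defined.

Fact z2_add_subproof x y n : x n.+1 + y n.+1 = x n + y n %[mod 2 ^ n].
Proof. by rewrite -modnDm -!z2P. Qed.
Fact z2_mul_subproof x y n : x n.+1 * y n.+1 = x n * y n %[mod 2 ^ n].
Proof. by rewrite -modnMm -!z2P. Qed.
Fact z2_opp_subproof x n :
  2 ^ n.+1 - x n.+1 = 2 ^ n - x n %[mod 2 ^ n].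
Proof.
have le_x m : x m <= 2 ^ m by rewrite -z2_mod ltnW // ltn_mod expn_gt0.
apply/eqP; rewrite -(eqn_modDr (x n.+1)) subnK //.
rewrite -[X in _ == X]modnDmr -z2P subnK // expnS mulnC modnMr modnn.
by [].
Qed.

Definition z2_add x y := z2_of (z2_add_subproof x y).
Definition z2_mul x y := z2_of (z2_mul_subproof x y).
Definition z2_opp x := z2_of (z2_opp_subproof x).
Definition z2_nat (m : nat) := @z2_of (fun=> m) (fun=> erefl).

Fact z2_addA : associative z2_add.
Proof. by move=> x y z; apply: Z2_eq => n /=; rewrite modnDml modnDmr addnA. Qed.
Fact z2_addC : commutative z2_add.
Proof. by move=> x y; apply: Z2_eq => n /=; rewrite addnC. Qed.
Fact z2_add0 : left_id (z2_nat 0) z2_add.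
Proof. by move=> x; apply: Z2_eq => n /=; rewrite mod0n add0n z2_mod. Qed.
Fact z2_addN : left_inverse (z2_nat 0) z2_opp z2_add.
Proof.
move=> x; apply: Z2_eq => n /=; rewrite modnDml subnK ?modnn ?mod0n //.
by rewrite -z2_mod ltnW // ltn_mod expn_gt0.
Qed.
HB.instance Definition _ :=
  GRing.isZmodule.Build Z2 z2_addA z2_addC z2_add0 z2_addN.

Fact z2_mulA : associative z2_mul.
Proof. by move=> x y z; apply: Z2_eq => n /=; rewrite modnMml modnMmr mulnA. Qed.
Fact z2_mulC : commutative z2_mul.
Proof. by move=> x y; apply: Z2_eq => n /=; rewrite mulnC. Qed.
Fact z2_mul1 : left_id (z2_nat 1) z2_mul.
Proof. by move=> x; apply: Z2_eq => n /=; rewrite modnMml mul1n z2_mod. Qed.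
Fact z2_mulD : left_distributive z2_mul z2_add.
Proof.
by move=> x y z; apply: Z2_eq => n /=; rewrite modnMml modnDm mulnDl.
Qed.
Fact z2_1neq0 : z2_nat 1 != 0%R.
Proof. by apply/eqP => /(congr1 (fun x => z2 x 1)). Qed.
HB.instance Definition _ :=
  GRing.Zmodule_isComNzRing.Build Z2 z2_mulA z2_mulC z2_mul1 z2_mulD z2_1neq0.

End Z2ring.

Definition Z2_unit : pred Z2 := fun x => `[< exists y, y * x = 1 >].
Definition Z2_inv (x : Z2) : Z2 :=
  if pselect (exists y, y * x = 1) is left ex then projT1 (cid ex) else x.
Fact Z2_mulVx : {in Z2_unit, left_inverse 1 Z2_inv *%R}.
Proof.
move=> x /asboolP ux; rewrite /Z2_inv.
by case: pselect => // ex; case: cid.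
Qed.
Fact Z2_unitPl (x y : Z2) : y * x = 1 -> Z2_unit x.
Proof. by move=> yx; apply/asboolP; exists y. Qed.
Fact Z2_inv_out : {in [predC Z2_unit], Z2_inv =1 id}.
Proof.
move=> x; rewrite inE /= => /asboolPn nx; rewrite /Z2_inv.
by case: pselect => // ex; case: nx.
Qed.
HB.instance Definition _ :=
  GRing.ComNzRing_hasMulInverse.Build Z2 Z2_mulVx Z2_unitPl Z2_inv_out.

Fact Z2_idomain (x y : Z2) : x * y = 0 -> (x == 0) || (y == 0).
Proof.
move=> xy0; apply: contraT; rewrite negb_or => /andP[x0 y0].
have nz (z : Z2) : z != 0 -> exists n, z n != 0%N.
  move=> z0; apply: contrapT => /forallNP h; case/eqP: z0; apply: Z2_eq => n.
  by have /negP := h n; rewrite negbK => /eqP ->; rewrite /= mod0n.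
have [m xm] := nz _ x0; have [n yn] := nz _ y0.
have := congr1 (fun z => z2 z (m + n)) xy0; rewrite /= mod0n => /eqP.
have nd (z : Z2) i j : (i <= j)%N -> z i != 0%N ->
    (0 < z j)%N && (logn 2 (z j) < i)%N.
  move=> ij; rewrite -(z2_le z ij); case: (posnP (z j)) => [->|zj].
    by rewrite mod0n eqxx.
  by rewrite -/(dvdn _ _) pfactor_dvdn //= -ltnNge.
have /andP[X0 X] := nd _ _ _ (leq_addr n m) xm.
have /andP[Y0 Y] := nd _ _ _ (leq_addl m n) yn.
rewrite -/(dvdn _ _) pfactor_dvdn ?muln_gt0 ?X0 ?Y0 // lognM // leqNgt.
by rewrite -addnS leq_add // ltnW.
Qed.
HB.instance Definition _ := GRing.ComUnitRing_isIntegral.Build Z2 Z2_idomain.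

Notation Q2 := {fraction Z2}.

(* Ring of integers O_K: the integral closure of Z_2 in K. *)
Section RingOfIntegers.

Variable K : fieldExtType Q2.

Definition Z2inK : {rmorphism Z2 -> K} := in_alg K \o @tofrac Z2.

Definition integers : {pred K} := fun x => `[< integralOver Z2inK x >].

Fact integers_subring : subring_closed integers.
Proof.
split=> [|x y /asboolP ix /asboolP iy|x y /asboolP ix /asboolP iy];
  apply/asboolP.
- exact: integral1.
- exact: integral_sub.
- exact: integral_mul.
Qed.
HB.instance Definition _ := GRing.isSubringClosed.Build K integers
  integers_subring.

Record OK := MkOK { OK_val :> K; _ : OK_val \in integers }.
HB.instance Definition _ := [isSub for OK_val].
HB.instance Definition _ := [Choice of OK by <:].
HB.instance Definition _ := [SubChoice_isSubComNzRing of OK by <:].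

(* 2 O_K is the maximal ideal m_K of O_K. *)
Definition unramified :=
  (forall y : OK, 2%:R * y != 1) /\
  (forall x : OK, (exists y, x = 2%:R * y) \/ (exists y, x * y = 1)).

End RingOfIntegers.

(* B, with the map p, is the quotient ring A / a A. *)
Definition is_quotient (A B : comNzRingType) (a : A) (p : {rmorphism A -> B}) :=
  (forall y, exists x, p x = y) /\
  (forall x, p x = 0 <-> exists y, x = a * y).

(* tr is the trace of R as an algebra, free of rank d, over Z/4. *)
Definition is_trace (d : nat) (R : comNzRingType) (tr : R -> 'Z_4) :=
  exists2 b : 'I_d -> R,
    bijective (fun c : 'rV['Z_4]_d => \sum_i b i *+ c 0 i) &
    forall r, exists2 A : 'M['Z_4]_d,
      forall i, r * b i = \sum_j b j *+ A i j & tr r = \tr A.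

Section SymplecticModules.

Variables (R : comNzRingType) (M : lmodType R) (om : M -> M -> R).

Definition symplectic_form :=
  [/\ forall w, scalar (om^~ w), forall v, scalar (om v),
      forall v, om v v = 0 & forall v, (forall w, om v w = 0) -> v = 0].

Definition free_submodule (S : {pred M}) :=
  exists r (b : 'I_r -> M), [/\ forall i, b i \in S,
    injective (fun c : 'rV[R]_r => \sum_i c 0 i *: b i) &
    forall v, v \in S -> exists c : 'rV[R]_r, v = \sum_i c 0 i *: b i].

End SymplecticModules.

(* S is equal to its orthogonal with respect to om. *)
Definition lagrangian (R : nmodType) (M : Type) (om : M -> M -> R)
    (S : {pred M}) :=
  forall v, v \in S <-> forall w, w \in S -> om v w = 0.

Record symplectic_datum (A : comNzRingType) (k : finFieldType)
    (R : finComNzRingType) (redk : {rmorphism A -> k})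
    (redR : {rmorphism A -> R}) (n : nat) := SymplecticDatum {
  Vt : vectType R;
  dimVt : dim Vt = n.*2;
  omt : Vt -> Vt -> R;
  omtP : symplectic_form omt;
  L0 : {pred Vt};
  M0 : {pred Vt};
  L0P : [/\ submod_closed L0, free_submodule L0 & lagrangian omt L0];
  M0P : [/\ submod_closed M0, free_submodule M0 & lagrangian omt M0];
  splitting : forall v, exists! p, [/\ p.1 \in L0, p.2 \in M0 & v = p.1 + p.2];
  betat : Vt -> Vt -> R;
  betatE : forall l1 m1 l2 m2, l1 \in L0 -> m1 \in M0 -> l2 \in L0 ->
    m2 \in M0 -> betat (l1 + m1) (l2 + m2) = omt l1 m2;
  (* V with the map redV is the quotient of Vt by 2 Vt, as a k-vector space *)
  V : finLmodType k;
  redV : {additive Vt -> V};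
  redV_scale : forall (a : A) v, redV (redR a *: v) = redk a *: redV v;
  redV_surj : forall v, exists vt, redV vt = v;
  redV_ker : forall vt, redV vt = 0 <-> exists wt, vt = wt *+ 2;
  om : V -> V -> R;
  omE : forall vt wt, om (redV vt) (redV wt) = omt vt wt *+ 2;
  beta : V -> V -> R;
  betaE : forall vt wt, beta (redV vt) (redV wt) = betat vt wt *+ 2 }.

Arguments Vt {A k R redk redR n}.
Arguments omt {A k R redk redR n}.
Arguments L0 {A k R redk redR n}.
Arguments M0 {A k R redk redR n}.
Arguments V {A k R redk redR n}.
Arguments redV {A k R redk redR n}.
Arguments om {A k R redk redR n}.

Section TensorPowers.

Variables (F : fieldType) (m : nat).

Definition multilinear (U : lmodType F) (B : ('I_m -> U) -> F) :=
  forall (u : 'I_m -> U) (i : 'I_m), scalar (fun x => B (dfwith (i := i) u x)).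

Record mform (U : lmodType F) := MForm {
  mform_fun :> ('I_m -> U) -> F;
  mformP : multilinear mform_fun }.

Lemma mform_ext (U : lmodType F) (B1 B2 : mform U) : B1 =1 B2 -> B1 = B2.
Proof.
case: B1 B2 => [B1 P1] [B2 P2] /= /funext B12; case: B2 / B12 P2 => P2.
by congr MForm; apply: Prop_irrelevance.
Qed.

(* Over a field, the pure tensor u_1 (x) ... (x) u_m is determined by its
   pairings B(u_1, ..., u_m) with all the multilinear forms B, and the tensor
   power is the span of pure tensors in the dual of the space of these forms. *)
Definition pure (U : lmodType F) (u : 'I_m -> U) : mform U -> F^o :=
  fun B => B u.

Definition tens_pred (U : lmodType F) : {pred mform U -> F^o} := fun t =>
  `[< exists s : seq (F * ('I_m -> U)), t = \sum_(x <- s) x.1 *: pure x.2 >].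

Fact tens_submod (U : lmodType F) : submod_closed (@tens_pred U).
Proof.
split=> [|a t1 t2 /asboolP[s1 ->] /asboolP[s2 ->]]; apply/asboolP.
  by exists [::]; rewrite big_nil.
exists ([seq (a * x.1, x.2) | x <- s1] ++ s2).
rewrite big_cat /= big_map scaler_sumr; congr (_ + _).
by apply: eq_bigr => x _; rewrite scalerA.
Qed.
HB.instance Definition _ (U : lmodType F) :=
  GRing.isSubmodClosed.Build F _ (@tens_pred U) (tens_submod U).

Record tens (U : lmodType F) := Tens {
  tens_val :> mform U -> F^o; _ : tens_val \in @tens_pred U }.
HB.instance Definition _ (U : lmodType F) := [isSub for @tens_val U].
HB.instance Definition _ (U : lmodType F) := [Choice of tens U by <:].
HB.instance Definition _ (U : lmodType F) :=
  [SubChoice_isSubLmodule of tens U by <:].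

Section Map.

Variables (U W : lmodType F) (f : 'I_m -> {linear U -> W}).

Fact mform_pull_subproof (B : mform W) :
  multilinear (fun u => B (fun i => f i (u i))).
Proof.
move=> u i a x y /=.
have fE z : (fun j => f j (dfwith (i := i) u z j)) =
            dfwith (i := i) (fun j => f j (u j)) (f i z) :> ('I_m -> W).
  apply/funext => j; case: (eqVneq i j) => [<-|ij].
    by rewrite !dfwith_in.
  by rewrite !dfwith_out.
by rewrite !fE linearP (mformP B).
Qed.
Definition mform_pull (B : mform W) := MForm (mform_pull_subproof B).

Fact tmap_subproof (t : tens U) :
  (fun B => t (mform_pull B)) \in @tens_pred W.
Proof.
case: t => t /= /asboolP[s ->]; apply/asboolP.
exists [seq (x.1, fun i => f i (x.2 i)) | x <- s].
by rewrite big_map; apply/funext => B; rewrite !fct_sumE.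
Qed.

(* f_1 (x) ... (x) f_m *)
Definition tmap (t : tens U) : tens W := Tens (tmap_subproof t).

Fact tmap_linear : linear tmap.
Proof. by move=> a s t; apply/val_inj/funext. Qed.
HB.instance Definition _ :=
  GRing.isLinear.Build F (tens U) (tens W) _ tmap tmap_linear.

End Map.

Fact pure_subproof (U : lmodType F) (u : 'I_m -> U) : pure u \in @tens_pred U.
Proof. by apply/asboolP; exists [:: (1, u)]; rewrite big_seq1 scale1r. Qed.
Definition ptens (U : lmodType F) (u : 'I_m -> U) := Tens (pure_subproof u).

Lemma tmap_ptens (U W : lmodType F) (f : 'I_m -> {linear U -> W}) u :
  tmap f (ptens u) = ptens (fun i => f i (u i)).
Proof. exact/val_inj/funext. Qed.

Lemma tmap_id (U : lmodType F) (f : 'I_m -> {linear U -> U}) :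
  (forall i, f i =1 id) -> tmap f =1 id.
Proof.
move=> fid t; apply/val_inj/funext => B /=; congr (tens_val t _).
by apply: mform_ext => u /=; congr (B _); apply/funext => i; rewrite fid.
Qed.

Lemma tmap_comp (U W X : lmodType F) (f : 'I_m -> {linear U -> W})
    (g : 'I_m -> {linear W -> X}) (h : 'I_m -> {linear U -> X}) :
  (forall i, h i =1 g i \o f i) -> tmap h =1 tmap g \o tmap f.
Proof.
move=> hE t; apply/val_inj/funext => B /=; congr (tens_val t _).
by apply: mform_ext => u /=; congr (B _); apply/funext => i; rewrite hE.
Qed.

End TensorPowers.

Lemma linear_ext (F : fieldType) (U W : lmodType F) (f g : {linear U -> W}) :
  f =1 g -> f = g.
Proof.
case: f g => [f [[f1] [f2]]] [g [[g1] [g2]]] /= /funext fg.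
case: g / fg g1 g2 => g1 g2.
by rewrite (Prop_irrelevance f1 g1) (Prop_irrelevance f2 g2).
Qed.

Record category := Category {
  obj :> Type;
  hom : obj -> obj -> Type;
  idm : forall X, hom X X;
  compm : forall X Y Z, hom Y Z -> hom X Y -> hom X Z;
  comp1m : forall X Y (f : hom X Y), compm (idm Y) f = f;
  compm1 : forall X Y (f : hom X Y), compm f (idm X) = f;
  compmA : forall X Y Z U (h : hom Z U) (g : hom Y Z) (f : hom X Y),
    compm h (compm g f) = compm (compm h g) f }.

Definition is_iso (D : category) (X Y : D) (f : hom X Y) :=
  exists g : hom Y X, compm g f = idm X /\ compm f g = idm Y.

Definition groupoid (D : category) := forall (X Y : D) (f : hom X Y), is_iso f.

Definition gerbe (D : category) :=
  [/\ groupoid D, inhabited D &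
      forall X Y : D, exists f : hom X Y, is_iso f].

(* The monoid of endomorphisms of X is isomorphic to the group of m-th roots of
   unity of F. *)
Definition end_is_mu (F : fieldType) (m : nat) (D : category) (X : D) :=
  exists chi : hom X X -> F,
    [/\ injective chi,
        forall f g, chi (compm f g) = chi f * chi g &
        forall z, m.-unity_root z <-> exists f, chi f = z].

Section Heisenberg.

Variables (A : comNzRingType) (k : finFieldType) (R : finComNzRingType).
Variables (redk : {rmorphism A -> k}) (redR : {rmorphism A -> R}) (n : nat).
Variable S : symplectic_datum redk redR n.

Lemma splitP (v : Vt S) : exists l m, [/\ l \in L0 S, m \in M0 S & v = l + m].
Proof. by have [[l m] [[]]] := splitting v; exists l, m. Qed.

Fact L0D (x y : Vt S) : x \in L0 S -> y \in L0 S -> x + y \in L0 S.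
Proof. by have [[_ h] _ _] := L0P S; rewrite -{2}[x]scale1r => *; exact: h. Qed.

Fact M0D (x y : Vt S) : x \in M0 S -> y \in M0 S -> x + y \in M0 S.
Proof. by have [[_ h] _ _] := M0P S; rewrite -{2}[x]scale1r => *; exact: h. Qed.

Lemma betaDl (v x y : V S) : beta (x + y) v = beta x v + beta y v.
Proof.
case: (redV_surj v) => vt <-; case: (redV_surj x) => xt <-.
case: (redV_surj y) => yt <-; rewrite -raddfD !betaE -mulrnDl; congr (_ *+ 2).
case: (splitP vt) => [vl [vm [vL vM ->]]].
case: (splitP xt) => [xl [xm [xL xM ->]]].
case: (splitP yt) => [yl [ym [yL yM ->]]].
rewrite addrACA !betatE ?L0D ?M0D //; case: (omtP S) => h _ _ _.
by have := h vm 1 xl yl; rewrite scale1r mul1r.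
Qed.

Lemma betaDr (v x y : V S) : beta v (x + y) = beta v x + beta v y.
Proof.
case: (redV_surj v) => vt <-; case: (redV_surj x) => xt <-.
case: (redV_surj y) => yt <-; rewrite -raddfD !betaE -mulrnDl; congr (_ *+ 2).
case: (splitP vt) => [vl [vm [vL vM ->]]].
case: (splitP xt) => [xl [xm [xL xM ->]]].
case: (splitP yt) => [yl [ym [yL yM ->]]].
rewrite addrACA !betatE ?L0D ?M0D //; case: (omtP S) => _ h _ _.
by have := h vl 1 xm ym; rewrite scale1r mul1r.
Qed.

Lemma beta0l (v : V S) : beta 0 v = 0.
Proof. by apply: (addrI (beta 0 v)); rewrite -betaDl !addr0. Qed.
Lemma beta0r (v : V S) : beta v 0 = 0.
Proof. by apply: (addrI (beta v 0)); rewrite -betaDr !addr0. Qed.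

Definition heis : Type := (V S * R)%type.
HB.instance Definition _ := Finite.on heis.

Definition heis_mul (g h : heis) : heis :=
  (g.1 + h.1, g.2 + h.2 + beta g.1 h.1).
Definition heis_one : heis := (0, 0).
Definition heis_inv (g : heis) : heis := (- g.1, - g.2 + beta g.1 g.1).

Fact heis_mulA : associative heis_mul.
Proof.
move=> [u x] [v y] [w z]; congr (_, _) => /=; first by rewrite addrA.
by rewrite betaDl betaDr; ring.
Qed.
Fact heis_mul1 : left_id heis_one heis_mul.
Proof. by move=> [v z]; rewrite /heis_mul /= beta0l !add0r addr0. Qed.
Fact heis_mulV : left_inverse heis_one heis_inv heis_mul.
Proof.
move=> [v z]; rewrite /heis_mul /= addNr; congr (_, _).
have -> : beta (- v) v = - beta v v.
  by apply: (addrI (beta v v)); rewrite -betaDl !subrr beta0l.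
by ring.
Qed.
HB.instance Definition _ :=
  Finite_isGroup.Build heis heis_mulA heis_mul1 heis_mulV.

Lemma heisM (g h : heis) :
  (g * h)%g = (g.1 + h.1, g.2 + h.2 + beta g.1 h.1).
Proof. by []. Qed.

Definition center (z : R) : heis := (0, z).

Lemma centerC z (g : heis) : (center z * g = g * center z)%g.
Proof.
by rewrite !heisM /= beta0l beta0r !addr0 !add0r addrC.
Qed.

(* The enhanced Lagrangians (L, tau), with tau = sec. *)
Record ELag := MkELag {
  lag : {set V S};
  lagP : submod_closed lag /\ lagrangian (om S) (mem lag);
  sec : {v | v \in lag} -> heis;
  sec_fst : forall l, (sec l).1 = val l;
  secM : forall l1 l2 l3, val l3 = val l1 + val l2 ->
    sec l3 = (sec l1 * sec l2)%g }.

Arguments sec : clear implicits.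

Definition transversal (M L : ELag) :=
  forall v, exists m l, [/\ m \in lag M, l \in lag L & v = m + l].

Variable Re : realType.
Let C := Re[i].

Section Bundles.

Variable m : nat.

(* H(V)^m-vector bundles; an element of H(V)^m is a function g : 'I_m -> H(V),
   multiplied componentwise. *)
Record bundle := Bundle {
  fib :> ELag -> lmodType C;
  act : forall L, ('I_m -> heis) -> {linear fib L -> fib L};
  act1 : forall L x, act L (fun=> 1%g) x = x;
  actM : forall L g h x, act L (fun i => g i * h i)%g x = act L g (act L h x) }.

Record trivialization (E : bundle) := Trivialization {
  triv :> forall M L, {linear E L -> E M};
  triv_bij : forall M L, bijective (triv M L);
  triv_act : forall M L g x, triv M L (act E L g x) = act E M g (triv M L x);
  triv_comp : forall N M L x, triv N M (triv M L x) = triv N L x }.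

Record bundle_iso (E1 E2 : bundle) := BundleIso {
  biso :> forall L, {linear E1 L -> E2 L};
  biso_bij : forall L, bijective (biso L);
  biso_act : forall L g x, biso L (act E1 L g x) = act E2 L g (biso L x) }.

End Bundles.

(* The H(V)^m-vector bundle E^{(x) m}: (g_1, ..., g_m) acts as
   g_1 (x) ... (x) g_m. *)
Section TensorBundle.

Variables (m : nat) (E : bundle 1).

Let tact L (g : 'I_m -> heis) : {linear tens m (E L) -> tens m (E L)} :=
  tmap (fun i => act E L (fun=> g i)).

Fact tact1 L x : tact L (fun=> 1%g) x = x.
Proof. by apply: tmap_id => i y; rewrite act1. Qed.

Fact tactM L g h x : tact L (fun i => g i * h i)%g x = tact L g (tact L h x).
Proof.
by move: x; apply: tmap_comp => i y /=; rewrite -actM.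
Qed.

Definition tens_bundle : bundle m := Bundle tact1 tactM.

End TensorBundle.

Section Model.

Variable tr : R -> 'Z_4.

Definition psi (z : R) : C :=
  let t := 2 * pi / 4 * (tr z)%:R in (cos t +i* sin t)%C.

Section Fiber.

Variable L : ELag.

Definition Hpred : {pred {ffun heis -> C}} := fun f =>
  `[< forall z l h, f (center z * sec L l * h)%g = psi z * f h >].

Fact Hpred_submod : submod_closed Hpred.
Proof.
split=> [|a f g /asboolP fP /asboolP gP]; apply/asboolP => z l h.
  by rewrite !ffunE mulr0.
by rewrite !ffunE fP gP mulrDr /GRing.scale /= mulrCA.
Qed.
HB.instance Definition _ :=
  GRing.isSubmodClosed.Build C {ffun heis -> C} Hpred Hpred_submod.

Record Hfun := MkHfun { Hval :> {ffun heis -> C}; _ : Hval \in Hpred }.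
HB.instance Definition _ := [isSub for Hval].
HB.instance Definition _ := [Choice of Hfun by <:].
HB.instance Definition _ := [SubChoice_isSubLmodule of Hfun by <:].

Fact Htrans_subproof (g : heis) (f : Hfun) :
  [ffun h => f (h * g)%g] \in Hpred.
Proof.
case: f => f /= /asboolP fP; apply/asboolP => z l h.
by rewrite !ffunE -mulgA fP.
Qed.
Definition Htrans g f : Hfun := MkHfun (Htrans_subproof g f).
Fact Htrans_linear g : linear (Htrans g).
Proof.
move=> a f1 f2; apply/val_inj/ffunP => h.
by rewrite !(ffunE, linearP) /=.
Qed.
HB.instance Definition _ g :=
  GRing.isLinear.Build C Hfun Hfun _ (Htrans g) (Htrans_linear g).

Fact Htrans1 f : Htrans 1%g f = f.
Proof. by apply/val_inj/ffunP => h; rewrite ffunE mulg1. Qed.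
Fact HtransM g1 g2 f : Htrans (g1 * g2)%g f = Htrans g1 (Htrans g2 f).
Proof. by apply/val_inj/ffunP => h; rewrite !ffunE mulgA. Qed.

End Fiber.

(* The bundle with fibers H_L, on which H(V) acts by right translations. *)
Definition Hbundle : bundle 1 :=
  @Bundle 1 Hfun (fun L g => Htrans (L := L) (g ord0))
    (fun L => @Htrans1 L) (fun L g1 g2 => @HtransM L (g1 ord0) (g2 ord0)).

Section Transform.

Variables M L : ELag.

(* The operator F_{M,L} of summation over tau(M); it is used only for M and L
   in general position. *)
Fact Fop_subproof (f : Hfun L) :
  [ffun h : heis => \sum_(m : {v | v \in lag M}) f (sec M m * h)%g]
    \in Hpred M.
Proof.
case: f => f /= /asboolP fP; apply/asboolP => z l h.
have [[lag0 lagZ] _] := lagP M.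
have addP (m : {v | v \in lag M}) : val m + val l \in lag M.
  by rewrite -[val m]scale1r; apply: lagZ; apply: valP.
have fz g : f (center z * g)%g = psi z * f g.
  have [[z0 _] _] := lagP L; pose o : {v | v \in lag L} := exist _ 0 z0.
  have so1 : sec L o = 1%g.
    apply: (mulgI (sec L o)); rewrite mulg1 -(@secM L o o o) //=.
    by rewrite addr0.
  by have := fP z o g; rewrite so1 mulg1.
pose s (m : {v | v \in lag M}) : {v | v \in lag M} :=
  exist (fun v => v \in lag M) _ (addP m).
have s_inj : injective s.
  by move=> m1 m2 /(congr1 val)/addIr/val_inj.
rewrite !ffunE mulr_sumr [in RHS](reindex_inj s_inj) /=.
have sM m : sec M (s m) = (sec M m * sec M l)%g by apply: secM.
by apply: eq_bigr => m _; rewrite -fz sM !mulgA centerC.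
Qed.
Definition Fop f : Hfun M := MkHfun (Fop_subproof f).
Fact Fop_linear : linear Fop.
Proof.
move=> a f g; apply/val_inj/ffunP => h.
rewrite !ffunE scaler_sumr -big_split /=; apply: eq_bigr => m _.
by rewrite !ffunE.
Qed.
HB.instance Definition _ :=
  GRing.isLinear.Build C (Hfun L) (Hfun M) _ Fop Fop_linear.

End Transform.

Arguments Fop : clear implicits.

Definition canonical_trivialization (d : nat)
    (T : trivialization (tens_bundle 4 Hbundle)) :=
  forall M L, transversal M L -> forall t,
    T M L t = ((-1) ^+ (d * n) / (#|lag M| ^ 2)%:R) *: tmap (fun=> Fop M L) t.

Section WeilGerbe.

Variable T : trivialization (tens_bundle 4 Hbundle).

Record Wobj := MkWobj {
  Wbundle :> bundle 1;
  Wtriv : trivialization Wbundle;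
  Wphi : bundle_iso Wbundle Hbundle;
  WphiP : forall M L t,
    tmap (m := 4) (fun=> Wphi M) (tmap (fun=> Wtriv M L) t) =
    T M L (tmap (fun=> Wphi L) t) }.

Record Whom (E1 E2 : Wobj) := MkWhom {
  Wmap :> forall L, {linear E1 L -> E2 L};
  Wmap_act : forall L g x, Wmap L (act E1 L g x) = act E2 L g (Wmap L x);
  Wmap_triv : forall M L x,
    Wmap M (Wtriv E1 M L x) = Wtriv E2 M L (Wmap L x);
  Wmap_phi : forall L t,
    tmap (m := 4) (fun=> Wphi E2 L) (tmap (fun=> Wmap L) t) =
    tmap (fun=> Wphi E1 L) t }.

Lemma Whom_ext (E1 E2 : Wobj) (f g : Whom E1 E2) :
  (forall L, f L =1 g L) -> f = g.
Proof.
case: f g => [f f1 f2 f3] [g g1 g2 g3] /= fg.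
have {}fg : f = g.
  by apply: functional_extensionality_dep => L; exact/linear_ext/fg.
case: g / fg g1 g2 g3 => g1 g2 g3.
by congr MkWhom; apply: Prop_irrelevance.
Qed.

Fact Wid_phi (E : Wobj) L t :
  tmap (m := 4) (fun=> Wphi E L) (tmap (fun=> idfun) t) =
  tmap (fun=> Wphi E L) t.
Proof. by rewrite [tmap (fun=> idfun) t]tmap_id. Qed.
Definition Wid (E : Wobj) : Whom E E :=
  @MkWhom E E (fun L => idfun) (fun _ _ _ => erefl) (fun _ _ _ => erefl)
    (@Wid_phi E).

Section Comp.

Variables (E1 E2 E3 : Wobj) (g : Whom E2 E3) (f : Whom E1 E2).

Let gf L : {linear E1 L -> E3 L} := g L \o f L.

Fact Wcomp_act L h x : gf L (act E1 L h x) = act E3 L h (gf L x).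
Proof. by rewrite /= !Wmap_act. Qed.
Fact Wcomp_triv M L x : gf M (Wtriv E1 M L x) = Wtriv E3 M L (gf L x).
Proof. by rewrite /= !Wmap_triv. Qed.
Fact Wcomp_phi L t :
  tmap (m := 4) (fun=> Wphi E3 L) (tmap (fun=> gf L) t) =
  tmap (fun=> Wphi E1 L) t.
Proof.
rewrite (tmap_comp (f := fun=> f L) (g := fun=> g L)) //=.
by rewrite Wmap_phi Wmap_phi.
Qed.
Definition Wcomp : Whom E1 E3 := MkWhom Wcomp_act Wcomp_triv Wcomp_phi.

End Comp.

Fact Wcomp1m (E1 E2 : Wobj) (f : Whom E1 E2) : Wcomp (Wid E2) f = f.
Proof. exact: Whom_ext. Qed.
Fact Wcompm1 (E1 E2 : Wobj) (f : Whom E1 E2) : Wcomp f (Wid E1) = f.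
Proof. exact: Whom_ext. Qed.
Fact WcompA (E1 E2 E3 E4 : Wobj) (h : Whom E3 E4) (g : Whom E2 E3)
    (f : Whom E1 E2) : Wcomp h (Wcomp g f) = Wcomp (Wcomp h g) f.
Proof. exact: Whom_ext. Qed.

Definition W : category := Category Wcomp1m Wcompm1 WcompA.

End WeilGerbe.
End Model.

End Heisenberg.

(* Main.v *)
Require Import Defs.
From HB Require Import structures.
From mathcomp Require Import all_boot all_order all_algebra all_fingroup all_field.
From mathcomp Require Import complex.
From mathcomp Require Import boolp classical_sets functions reals trigo.
From mathcomp Require Import ring.

(** The theorem follows from Schur's lemma, for each representation H_L of the
    Heisenberg group H(V) and for the fourth tensor power of H_L as
    a representation of H(V)^4.

    Both come from one observation. Let delta be the function of H_L supported on
    Z tau(L). The average of the right translations by Z tau(L), twisted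
    by a character, is a projection of H_L onto the line of delta: a function
    survives only at the points x with psi(om(x, l)) = 1 for all l in L, that is, on
    Z tau(L), as L is Lagrangian. An intertwiner commutes with this
    projection, hence scales delta, and delta is a cyclic vector, hence the intertwiner
    is a scalar ([intertwiner_scalar]). In the tensor power, the tensor power of the
    projection plays the same part ([tens_intertwiner_scalar]). A nonzero intertwiner
    from H_L to H_M is obtained by averaging for any two enhanced Lagrangians
    ([kernel_map_neq0]), and it is bijective ([intertwiner_bij]).

    The orthogonality of characters used here needs that psi is nontrivial on the
    ideal generated by each nonzero element of 2R. This is the nondegeneracy of the
    trace form of k over F_2, and it reduces to the existence of an element
    of odd trace ([trace_odd]), which is proved by diagonalizing the multiplication
    matrices over k.

    Schur's lemma makes each T_(M,L) the fourth tensor power of an isomorphism from H_L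
    to H_M ([triv_fourth_root]), whence an object of W: the constant bundle with
    fiber H_B for some base point B ([ELag_exists], [Wobj_exists]). Two objects
    are isomorphic by transporting to all fibers their identification
    with H_B over B ([Whom_exists]). Finally, a morphism is in each fiber a scalar with
    fourth power 1 with respect to the two maps to H_L ([Whom_scalar]); so it is
    invertible, and an endomorphism is one and the same fourth root of unity on
    all the fibers. *)

Set Implicit Arguments.
Unset Strict Implicit.
Unset Printing Implicit Defensive.

Import Order.TTheory GRing.Theory Num.Theory.
Local Open Scope ring_scope.

(** * Tensor powers *)

Local Notation upd u j x := (@dfwith _ _ u j x).

Section SlotInduction.

Variables (m : nat) (D : Type) (X Y : D -> Prop) (Q : ('I_m -> D) -> Prop).

Lemma dfwith_eta (u : 'I_m -> D) j : upd u j (u j) = u.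
Proof.
apply/funext => i; case: (eqVneq j i) => [<-|ne]; first by rewrite dfwith_in.
by rewrite dfwith_out.
Qed.

(** Statements on families indexed by ['I_m] are proved for families in [X] and
    then extended to families in [Y], changing one slot at a time: after [j]
    rounds they hold when the first [j] entries are in [Y] and the other ones
    in [X]. This replaces the expansion of a multilinear expression into a sum
    over families of indices. *)
Lemma slot_ind :
  (forall u, (forall i, X (u i)) -> Q u) ->
  (forall u j y, Y y -> (forall x, X x -> Q (upd u j x)) ->
    Q (upd u j y)) ->
  forall u, (forall i, Y (u i)) -> Q u.
Proof.
move=> base step u uY.
suff H j v : (j <= m)%N -> (forall i : 'I_m, (i < j)%N -> Y (v i)) ->
    (forall i : 'I_m, (j <= i)%N -> X (v i)) -> Q v.
  by apply: (H m) => // i; rewrite leqNgt ltn_ord.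
elim: j v => [|j IHj] v jm vY vX; first by apply: base => i; apply: vX.
rewrite -(dfwith_eta v (Ordinal jm)); apply: step => [|x Xx]; first exact: vY.
apply: IHj => [|i ij|i ij]; first exact: ltnW.
  by rewrite dfwith_out; [apply: vY; apply: ltn_trans ij _ | rewrite -val_eqE /= gtn_eqF].
case: (eqVneq (Ordinal jm) i) => [<-|ne]; first by rewrite dfwith_in.
by rewrite dfwith_out //; apply: vX; rewrite ltn_neqAle ij andbT; move: ne; rewrite -val_eqE.
Qed.

End SlotInduction.

Section TensorAlgebra.

Variables (F : fieldType) (m : nat).
Implicit Types U W X : lmodType F.

Lemma ptens_linear U (u : 'I_m -> U) j :
  linear (fun x => ptens (upd u j x)).
Proof. move=> a x y; apply/val_inj/funext => B; exact: (mformP B u j a x y). Qed.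

Lemma ptens_slot U (u : 'I_m -> U) j : exists g : {linear U -> tens m U},
  forall x, ptens (upd u j x) = g x.
Proof.
by exists (HB.pack_for {linear U -> tens m U} (fun x => ptens (upd u j x))
  (GRing.isLinear.Build F U (tens m U) _ _ (ptens_linear u j))).
Qed.

Lemma ptensZ U (u : 'I_m -> U) j a x :
  ptens (upd u j (a *: x)) = a *: ptens (upd u j x).
Proof. by have [g gE] := ptens_slot u j; rewrite !gE linearZ. Qed.

Lemma ptens_sum U (I : finType) (u : 'I_m -> U) j (a : I -> F) (x : I -> U) :
  ptens (upd u j (\sum_i a i *: x i)) =
  \sum_i a i *: ptens (upd u j (x i)).
Proof.
have [g gE] := ptens_slot u j; rewrite gE linear_sum.
by apply: eq_bigr => i _; rewrite linearZ gE.
Qed.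

Lemma tensE U (t : tens m U) : exists s : seq (F * ('I_m -> U)),
  t = \sum_(x <- s) x.1 *: ptens x.2.
Proof.
case: (t) => v vP; have /asboolP[s vE] := vP; exists s; apply/val_inj => /=.
by rewrite vE; elim/big_rec2: _ => // x y1 y2 _ ->.
Qed.

Lemma ptens_scale U (a : 'I_m -> F) (u : 'I_m -> U) :
  ptens (fun i => a i *: u i) = (\prod_i a i) *: ptens u.
Proof.
pose w i := (a i, u i); pose Q (w : 'I_m -> F * U) :=
  ptens (fun i => (w i).1 *: (w i).2) =
  (\prod_i (w i).1) *: ptens (fun i => (w i).2).
have dfE (D : Type) (h : F * U -> D) v (j : 'I_m) y :
    (fun i => h (upd v j y i)) = upd (fun i => h (v i)) j (h y).
  apply/funext => i; case: (eqVneq j i) => [<-|ji]; first by rewrite !dfwith_in.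
  by rewrite !dfwith_out.
apply: (@slot_ind m _ (fun x => x.1 = 1) (fun=> True) Q _ _ w) => //.
- move=> v v1; rewrite /Q big1 ?scale1r //.
  by congr ptens; apply/funext => i; rewrite v1 scale1r.
- move=> v j y _ /(_ (1, y.2) erefl); rewrite /Q.
  rewrite !(dfE U (fun w => w.1 *: w.2)) !(dfE U snd) /= scale1r.
  rewrite ptensZ => ->; rewrite scalerA; congr (_ *: _).
  rewrite (bigD1 j) //= dfwith_in mul1r [RHS](bigD1 j) //= dfwith_in.
  congr (_ * _); apply: eq_bigr => i ij.
  by rewrite !dfwith_out // eq_sym.
Qed.

Definition homothety U (a : F) (x : U) : U := a *: x.
Fact homothety_linear U a : linear (@homothety U a).
Proof. by move=> b x y; rewrite /homothety scalerDr !scalerA mulrC. Qed.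
HB.instance Definition _ U a :=
  GRing.isLinear.Build F U U _ (@homothety U a) (@homothety_linear U a).

Lemma tmap_scale U (f : {linear U -> U}) a : (forall x, f x = a *: x) ->
  forall t : tens m U, tmap (fun=> f) t = a ^+ m *: t.
Proof.
move=> fE t; have [s ->] := tensE t; rewrite linear_sum scaler_sumr.
apply: eq_bigr => x _; rewrite linearZ /= tmap_ptens scalerA mulrC -scalerA.
congr (_ *: _); have -> : a ^+ m = \prod_(i < m) a by rewrite prodr_const card_ord.
rewrite -ptens_scale.
by congr ptens; apply/funext => i.
Qed.

Lemma tmap_slot U W (I : finType) (f : 'I_m -> {linear U -> W}) j
    (p : {linear U -> W}) (c : I -> F) (r : I -> {linear U -> W}) :
  (forall u, p u = \sum_i c i *: r i u) ->
  forall t, tmap (upd f j p) t = \sum_i c i *: tmap (upd f j (r i)) t.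
Proof.
move=> pE t; have [s ->] := tensE t.
under [RHS]eq_bigr do rewrite linear_sum scaler_sumr.
rewrite exchange_big linear_sum; apply: eq_bigr => x _ /=.
under [RHS]eq_bigr do rewrite linearZ /= scalerA mulrC -scalerA.
rewrite linearZ -scaler_sumr /=; congr (_ *: _).
have dfE (q : {linear U -> W}) : tmap (upd f j q) (ptens x.2) =
    ptens (upd (fun i => f i (x.2 i)) j (q (x.2 j))).
  rewrite tmap_ptens; congr ptens; apply/funext => i.
  case: (eqVneq j i) => [<-|ji]; first by rewrite !dfwith_in.
  by rewrite !dfwith_out.
by rewrite dfE pE ptens_sum; apply: eq_bigr => i _; rewrite dfE.
Qed.

Lemma tmap_tmap U W X (f : 'I_m -> {linear U -> W}) (g : 'I_m -> {linear W -> X})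
    (h : 'I_m -> {linear U -> X}) (t : tens m U) :
  (forall i x, g i (f i x) = h i x) -> tmap g (tmap f t) = tmap h t.
Proof. by move=> gf; rewrite (tmap_comp (f := f) (g := g)) // => i x /=. Qed.

Lemma tmap_cancel U W (f : {linear U -> W}) (g : {linear W -> U}) (t : tens m U) :
  cancel f g -> tmap (fun=> g) (tmap (fun=> f) t) = t.
Proof. by move=> fK; rewrite (tmap_tmap (h := fun=> idfun)) ?tmap_id. Qed.

End TensorAlgebra.

Lemma linear_inverse (F : fieldType) (U W : lmodType F) (f : {linear U -> W}) :
  bijective f -> exists g : {linear W -> U}, cancel f g /\ cancel g f.
Proof.
case=> g fK gK; have lin_g : linear g.
  by move=> a x y; rewrite -[in LHS](gK x) -[in LHS](gK y) -linearP fK.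
by exists (HB.pack_for {linear W -> U} g (GRing.isLinear.Build F W U _ g lin_g)).
Qed.

(** * Representations with a rank one projection *)

Section RankOne.

Variable (F : fieldType).

(** A certificate of absolute irreducibility for the family of operators [r]: some
    combination of the [r g] is a projection onto the line of [gen], this vector
    is cyclic, and every nonzero vector is moved by some [r g] to a vector with
    a nonzero projection. The rank one projection is what makes
    the argument pass to tensor powers, where its own tensor power again projects
    onto a line. *)
Record rank_one (G : finType) (U : lmodType F) (r : G -> {linear U -> U}) :=
  RankOne {
    gen : U;
    cf : G -> F;
    ev : {linear U -> F^o};
    projE : forall u, \sum_g cf g *: r g u = ev u *: gen;
    ev_gen : ev gen = 1;
    gen_span : forall u, exists a : G -> F, u = \sum_g a g *: r g gen;
    ev_sep : forall u, (forall g, ev (r g u) = 0) -> u = 0 }.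

Arguments ev_sep {G U r} _ u.

Section Schur.

Variables (G : finType) (U : lmodType F) (r : G -> {linear U -> U}).
Variable H : rank_one r.

Lemma proj_gen : \sum_g cf H g *: r g (gen H) = gen H.
Proof. by rewrite projE ev_gen scale1r. Qed.

Lemma gen_neq0 : gen H != 0.
Proof.
by apply/eqP => g0; have /eqP := ev_gen H; rewrite g0 linear0 eq_sym oner_eq0.
Qed.

Lemma ptens_gen_neq0 m : ptens (fun=> gen H) != 0 :> tens m U.
Proof.
pose B (u : 'I_m -> U) : F := \prod_i ev H (u i).
have BP : multilinear B.
  move=> u i a x y; rewrite /B !(bigD1 (P := xpredT) i) //= !dfwith_in linearP.
  rewrite -[_ *: ev H x]/(a * ev H x) mulrDl -mulrA.
  by congr (a * (_ * _) + _ * _); apply: eq_bigr => j ji; rewrite !dfwith_out // eq_sym.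
apply/eqP => /(congr1 (fun t => tens_val t (MForm BP))); apply/eqP.
by rewrite /= /pure /= /B big1 ?oner_eq0 // => i _; apply: ev_gen.
Qed.

(** An intertwiner commutes with the projection onto the line of [gen], so it
    preserves this line, and a cyclic vector determines it. *)
Lemma intertwiner_scalar (f : {linear U -> U}) :
  (forall g u, f (r g u) = r g (f u)) -> exists a, forall u, f u = a *: u.
Proof.
move=> fr; exists (ev H (f (gen H))) => u.
have fgen : f (gen H) = ev H (f (gen H)) *: gen H.
  rewrite -projE -[in LHS]proj_gen linear_sum.
  by apply: eq_bigr => g _; rewrite linearZ fr.
have [a ->] := gen_span H u; rewrite linear_sum scaler_sumr.
apply: eq_bigr => g _; rewrite linearZ /= fr {1}fgen linearZ.
by rewrite !scalerA mulrC.
Qed.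

Definition proj u := \sum_g cf H g *: r g u.
Fact proj_linear : linear proj.
Proof.
move=> a x y; rewrite scaler_sumr -big_split /=; apply: eq_bigr => g _.
by rewrite linearP scalerDr !scalerA mulrC.
Qed.
HB.instance Definition _ := GRing.isLinear.Build F U U _ proj proj_linear.

(** The same proof in the tensor power. The m-th tensor power of the projection is
    not visibly a combination of the operators by which the group acts, so its
    commutation with [f] is proved by changing one slot at a time from an operator
    [r g] to the projection. *)
Lemma tens_intertwiner_scalar m (f : {linear tens m U -> tens m U}) :
  (forall (g : 'I_m -> G) t,
    f (tmap (fun i => r (g i)) t) = tmap (fun i => r (g i)) (f t)) ->
  exists a, forall t, f t = a *: t.
Proof.
move=> fr.
have fproj t : f (tmap (fun=> proj) t) = tmap (fun=> proj) (f t).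
  pose Q (w : 'I_m -> {linear U -> U}) := forall t, f (tmap w t) = tmap w (f t).
  apply: (@slot_ind m _ (fun h => exists g, h = r g) (fun h => h = proj) Q)
    => // [w wr|w j _ -> Qr] {}t.
  - have [g gE] := choice wr.
    by have -> : w = (fun i => r (g i)) by apply/funext.
  - rewrite !(tmap_slot w j (fun u => erefl (proj u))) linear_sum.
    by apply: eq_bigr => g _; rewrite linearZ /= Qr //; exists g.
pose e : tens m U := ptens (fun=> gen H).
have line t : exists a, tmap (fun=> proj) t = a *: e.
  have [s ->] := tensE t; elim/big_ind: _ => [|x y [a xE] [b yE]|x _].
  - by exists 0; rewrite linear0 scale0r.
  - by exists (a + b); rewrite linearD scalerDl -xE -yE.
  - exists (x.1 * \prod_i ev H (x.2 i)); rewrite linearZ /= tmap_ptens -scalerA.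
    by rewrite -ptens_scale; congr (_ *: ptens _); apply/funext => i; apply: projE.
have [a fe] := line (f e); exists a.
(* The tensor power of the projection fixes [e], and it commutes with [f]. *)
have {}fe : f e = a *: e.
  rewrite -fe -fproj tmap_ptens; congr (f (ptens _)).
  by apply/funext => i; rewrite [RHS]proj_gen.
pose Q w := f (ptens w) = a *: ptens w.
have Qall w : Q w.
  apply: (@slot_ind m U (fun x => exists g, x = r g (gen H)) (fun=> True) Q)
    => // [{}w wr|{}w j y _ Qr].
  - have [g gE] := choice wr.
    have wE : ptens w = tmap (fun i => r (g i)) e.
      by rewrite tmap_ptens; congr ptens; apply/funext.
    by rewrite /Q wE fr fe linearZ.
  - rewrite /Q; have [b ->] := gen_span H y.
    rewrite ptens_sum linear_sum scaler_sumr; apply: eq_bigr => g _.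
    by rewrite linearZ /= Qr ?scalerA 1?mulrC //; exists g.
move=> t; have [s ->] := tensE t; rewrite linear_sum scaler_sumr.
by apply: eq_bigr => x _; rewrite linearZ /= Qall !scalerA mulrC.
Qed.

End Schur.

(** The projection onto the line of the generator separates the kernel from a
    nonzero vector and reaches the generator of the target from a nonzero
    value of [f]. *)
Lemma intertwiner_bij (G : finType) (U1 U2 : lmodType F)
    (r1 : G -> {linear U1 -> U1}) (r2 : G -> {linear U2 -> U2})
    (H1 : rank_one r1) (H2 : rank_one r2) (f : {linear U1 -> U2}) :
  (forall g u, f (r1 g u) = r2 g (f u)) -> (exists u, f u != 0) -> bijective f.
Proof.
move=> fr [u0 fu0].
have fgen : f (gen H1) != 0.
  apply: contraNN fu0 => /eqP fg0; have [a ->] := gen_span H1 u0.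
  by rewrite linear_sum big1 // => g _; rewrite linearZ /= fr fg0 linear0 scaler0.
have inj0 u : f u = 0 -> u = 0.
  move=> fu; apply: (ev_sep H1) => g; apply/eqP.
  have := congr1 f (projE H1 (r1 g u)).
  rewrite linearZ linear_sum big1 => [/esym/eqP|h _]; last first.
    by rewrite linearZ /= !fr fu !linear0.
  by rewrite scaler_eq0 (negPf fgen) orbF.
have [v fv] : exists v, f v = gen H2.
  have [g hg] : exists g, ev H2 (r2 g (f u0)) != 0.
    apply: contrapT => /forallNP h; case/eqP: fu0.
    by apply: (ev_sep H2) => g; apply/eqP; have /negP := h g; rewrite negbK.
  exists ((ev H2 (r2 g (f u0)))^-1 *: \sum_k cf H2 k *: r1 k (r1 g u0)).
  rewrite linearZ linear_sum /=.
  under eq_bigr do rewrite linearZ /= !fr.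
  by rewrite projE scalerA mulVf // scale1r.
have surj w : exists u, f u = w.
  have [a ->] := gen_span H2 w; exists (\sum_g a g *: r1 g v).
  by rewrite linear_sum; apply: eq_bigr => g _; rewrite linearZ /= fr fv.
have [h hE] := choice surj; exists h => // u.
by apply/eqP; rewrite -subr_eq0; apply/eqP/inj0; rewrite linearB hE subrr.
Qed.

End RankOne.

(** * The representations of the Heisenberg group *)

Section Datum.

Variables (A : comNzRingType) (k : finFieldType) (R : finComNzRingType).
Variables (redk : {rmorphism A -> k}) (redR : {rmorphism A -> R}) (n : nat).
Variable S : symplectic_datum redk redR n.

Lemma omtDl (x y v : Vt S) : omt S (x + y) v = omt S x v + omt S y v.
Proof.
by have [omL _ _ _] := omtP S; have := omL v 1 x y; rewrite scale1r /= mul1r.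
Qed.

Lemma omtDr (v x y : Vt S) : omt S v (x + y) = omt S v x + omt S v y.
Proof.
by have [_ omR _ _] := omtP S; have := omR v 1 x y; rewrite scale1r /= mul1r.
Qed.

Lemma omt0r (v : Vt S) : omt S v 0 = 0.
Proof. by apply: (addrI (omt S v 0)); rewrite -omtDr !addr0. Qed.

Lemma omtC (x y : Vt S) : omt S x y = - omt S y x.
Proof.
have [_ _ om0 _] := omtP S; apply/eqP; rewrite -addr_eq0; apply/eqP.
by rewrite -[RHS](om0 (x + y)) omtDl !omtDr !om0 add0r addr0.
Qed.

Lemma omE_beta (v w : V S) : om S v w = beta v w - beta w v.
Proof.
case: (redV_surj v) => vt <-; case: (redV_surj w) => wt <-.
rewrite omE !betaE -mulrnBl; congr (_ *+ 2).
have [vl [vm [vL vM ->]]] := Defs.splitP vt.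
have [wl [wm [wL wM ->]]] := Defs.splitP wt.
rewrite !betatE // omtDl !omtDr.
have [_ _ L0L] := L0P S; have [_ _ M0L] := M0P S.
rewrite (proj1 (L0L vl) vL wl wL) (proj1 (M0L vm) vM wm wM).
by rewrite add0r addr0 -omtC.
Qed.

Lemma omDr (v x y : V S) : om S v (x + y) = om S v x + om S v y.
Proof. by rewrite !omE_beta betaDl betaDr; ring. Qed.

Lemma omC (v w : V S) : om S v w = - om S w v.
Proof. by rewrite !omE_beta opprB. Qed.

Lemma om0r (v : V S) : om S v 0 = 0.
Proof. by rewrite omE_beta beta0l beta0r subrr. Qed.

Lemma omZ (a : A) (v w : V S) : om S v (redk a *: w) = redR a * om S v w.
Proof.
case: (redV_surj v) => vt <-; case: (redV_surj w) => wt <-.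
have [_ omR _ _] := omtP S; rewrite -redV_scale !omE.
have := omR vt (redR a) wt 0; rewrite addr0 /= omt0r addr0 => ->.
by rewrite mulrnAr.
Qed.

Local Notation heis := (heis S).
Implicit Types (x y g h : heis).

Lemma heis_fstM x y : (x * y)%g.1 = x.1 + y.1.
Proof. by []. Qed.

Lemma heis_fstV x : (x^-1)%g.1 = - x.1.
Proof. by []. Qed.

Lemma heis_commute x y :
  (x * y)%g = (center S (om S x.1 y.1) * (y * x))%g.
Proof.
rewrite !heisM /= beta0l add0r addr0 omE_beta [y.1 + _]addrC.
by congr (_, _); ring.
Qed.

Lemma heis_conj g h :
  (g^-1 * h * g)%g = (center S (om S h.1 g.1) * h)%g.
Proof.
by rewrite -mulgA (heis_commute h g) mulgA -centerC -mulgA mulKg.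
Qed.

Variables (Re : realType) (tr : R -> 'Z_4).
Local Notation C := Re[i].
Local Notation psi := (psi Re tr).

Hypothesis psi0 : psi 0 = 1.
Hypothesis psiD : forall z1 z2, psi (z1 + z2) = psi z1 * psi z2.
Hypothesis psi_nondeg : forall v w : V S, om S v w != 0 ->
  exists a : k, psi (om S v (a *: w)) != 1.
Hypothesis om_nondeg : forall v : V S, v != 0 -> exists w, om S v w != 0.

(** Translation by [g] multiplies the sum by a constant other than 1. *)
Lemma sum_char (P : pred heis) (v : V S) (g : heis) :
  (forall h, P (g * h)%g = P h) -> psi (om S v g.1) != 1 ->
  \sum_(h | P h) psi (om S v h.1) = 0.
Proof.
move=> Pg ng; set s := LHS.
have : psi (om S v g.1) * s = s.
  rewrite {2}/s (reindex_inj (mulgI g)) mulr_sumr /=.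
  by apply: eq_big => h; rewrite ?Pg // omDr psiD.
move/eqP; rewrite -subr_eq0 -{2}[s]mul1r -mulrBl mulf_eq0 subr_eq0.
by rewrite (negPf ng) => /eqP.
Qed.

Section Fiber.

Variable L : ELag S.

Lemma lag0 : 0 \in lag L.
Proof. by have [[]] := lagP L. Qed.

Lemma lagD v w : v \in lag L -> w \in lag L -> v + w \in lag L.
Proof.
by move=> vL wL; have [[_ h] _] := lagP L; rewrite -[v]scale1r; apply: h.
Qed.

Lemma lagZ a v : v \in lag L -> a *: v \in lag L.
Proof.
by move=> vL; have [[_ h] _] := lagP L; rewrite -[_ *: _]addr0; apply: h => //; exact: lag0.
Qed.

Lemma lagDr v w : v \in lag L -> (v + w \in lag L) = (w \in lag L).
Proof.
move=> vL; apply/idP/idP => [vwL|]; last exact: lagD.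
by rewrite -[w](addKr v) lagD // -scaleN1r lagZ.
Qed.

Lemma lagN v : (- v \in lag L) = (v \in lag L).
Proof.
by apply/idP/idP => /(lagZ (-1)); rewrite scaleN1r ?opprK.
Qed.

(** The function supported on Z tau(L) which equals psi on Z and 1 on tau(L);
    [x.2 - (sec l).2] is the central component of [x]. *)
Definition delta_fun x : C :=
  if insub x.1 is Some l then psi (x.2 - (sec (e := L) l).2) else 0.

Lemma delta_out x : x.1 \notin lag L -> delta_fun x = 0.
Proof. by move=> xL; rewrite /delta_fun insubN. Qed.

Lemma delta_in z l : delta_fun (center S z * sec (e := L) l)%g = psi z.
Proof.
rewrite /delta_fun heisM /= add0r sec_fst valK beta0l addr0; congr psi.
by rewrite addrK.
Qed.

Lemma heis_lag x : x.1 \in lag L ->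
  exists z l, x = (center S z * sec (e := L) l)%g.
Proof.
move=> xL; pose l : {v | v \in lag L} := exist _ x.1 xL.
exists (x.2 - (sec (e := L) l).2), l; rewrite heisM /= sec_fst beta0l add0r addr0.
by rewrite subrK; case: x xL @l.
Qed.

Lemma delta_subproof : [ffun x => delta_fun x] \in Hpred (Re := Re) tr L.
Proof.
apply/asboolP => z l h; rewrite !ffunE.
have fstE : (center S z * sec (e := L) l * h)%g.1 = val l + h.1.
  by rewrite /= sec_fst add0r.
have [hL|hL] := boolP (h.1 \in lag L); last first.
  by rewrite !delta_out ?mulr0 // fstE lagDr // (valP l).
have [z' [l' ->]] := heis_lag hL.
pose l2 : {v | v \in lag L} := exist _ (val l + val l') (lagD (valP l) (valP l')).
have lE : sec (e := L) l2 = (sec l * sec l')%g by exact: secM.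
have -> : (center S z * sec l * (center S z' * sec l') =
           center S (z + z') * sec (e := L) l2)%g.
  rewrite lE !mulgA -[(center S z * sec l * _)%g]mulgA -centerC !mulgA.
  by congr (_ * _ * _)%g; rewrite heisM /= beta0l !addr0.
by rewrite !delta_in psiD.
Qed.
Definition delta : Hfun Re tr L := MkHfun delta_subproof.

Lemma deltaE x : delta x = delta_fun x.
Proof. by rewrite ffunE. Qed.

Lemma HfunM (f : Hfun Re tr L) x y : x.1 \in lag L ->
  f (x * y)%g = delta x * f y.
Proof.
move=> /heis_lag[z [l ->]]; rewrite deltaE delta_in.
by case: f => f /= /asboolP ->.
Qed.

Lemma delta_center z : delta (center S z) = psi z.
Proof.
pose o : {v | v \in lag L} := exist _ 0 lag0.
have o1 : sec (e := L) o = 1%g.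
  apply: (mulgI (sec o)); rewrite mulg1 -(secM (l3 := o)) //=.
  by rewrite addr0.
by rewrite deltaE -[center S z]mulg1 -o1 delta_in.
Qed.

Lemma Hfun_center (f : Hfun Re tr L) z y : f (center S z * y)%g = psi z * f y.
Proof. by rewrite HfunM ?delta_center //= lag0. Qed.

Lemma delta1 : delta 1%g = 1.
Proof. by rewrite (delta_center 0). Qed.

Lemma deltaV x : x.1 \in lag L -> delta (x^-1)%g * delta x = 1.
Proof. by move=> xL; rewrite -HfunM ?mulVg ?delta1 // heis_fstV lagN. Qed.

Definition card_ZL : nat := #|[pred x : heis | x.1 \in lag L]|.

Lemma card_ZL_neq0 : card_ZL%:R != 0 :> C.
Proof.
rewrite pnatr_eq0 -lt0n; apply/card_gt0P; exists 1%g.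
by rewrite inE lag0.
Qed.

(** As L is its own orthogonal, the pairing with a vector outside L is
    a nontrivial character of L. *)
Lemma sum_char_lag v :
  \sum_(h : heis | h.1 \in lag L) psi (om S v h.1) =
  if v \in lag L then card_ZL%:R else 0.
Proof.
have [_ lagL] := lagP L; case: ifPn => [vL|vL].
  rewrite /card_ZL -sum1_card natr_sum; apply: eq_bigr => h hL.
  by rewrite (proj1 (lagL v) vL).
have [w wL /psi_nondeg[a na]] : exists2 w, w \in lag L & om S v w != 0.
  apply: contrapT => nw; case/negP: vL; apply/lagL => w wL.
  by apply/eqP; apply: contrapT => /negP vw; apply: nw; exists w.
apply: (@sum_char _ v (a *: w, 0)) => // h.
by rewrite heis_fstM lagDr // lagZ.
Qed.

Definition at1 (f : Hfun Re tr L) : C^o := f 1%g.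
Fact at1_linear : linear at1.
Proof. by move=> a f1 f2; rewrite /at1 !ffunE. Qed.
HB.instance Definition _ :=
  GRing.isLinear.Build C (Hfun Re tr L) C^o _ at1 at1_linear.

(** Averaging the right translates by Z tau(L) against the inverse of the
    character [delta] gives a projection. Passing tau(l) through [x] costs the factor
    psi(om(x, l)), so averaging over l kills [f x] for [x] outside Z tau(L), and on
    Z tau(L) the covariance of [f] makes it [f 1] times [delta]. *)
Lemma proj_delta (f : Hfun Re tr L) :
  \sum_g (card_ZL%:R^-1 * delta (g^-1)%g) *: Htrans g f = f 1%g *: delta.
Proof.
apply/val_inj/ffunP => x.
transitivity (card_ZL%:R^-1 * \sum_(g : heis) delta (g^-1)%g * f (x * g)%g).
  rewrite raddf_sum sum_ffunE mulr_sumr; apply: eq_bigr => g _.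
  by rewrite !ffunE -[_ *: _]mulrA.
have -> : \sum_(g : heis) delta (g^-1)%g * f (x * g)%g =
    \sum_(g : heis | g.1 \in lag L) psi (om S x.1 g.1) * f x.
  rewrite [RHS]big_mkcond; apply: eq_bigr => g _.
  case: ifPn => [gL|gL]; last first.
    by rewrite deltaE delta_out ?mul0r // heis_fstV lagN.
  by rewrite heis_commute Hfun_center HfunM // mulrCA (mulrA (delta _)) deltaV // mul1r.
rewrite -mulr_suml sum_char_lag !ffunE; case: ifPn => xL.
  by rewrite mulrA mulVf ?card_ZL_neq0 // mul1r -{1}[x]mulg1 HfunM // mulrC -deltaE.
by rewrite delta_out ?mul0r ?mulr0 ?scaler0.
Qed.

(** A function of H_L is determined on each coset of Z tau(L) by one value, and
    each coset is the support of a translate of [delta]. *)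
Lemma delta_span (f : Hfun Re tr L) : exists a : heis -> C,
  f = \sum_g a g *: Htrans g delta.
Proof.
exists (fun g => card_ZL%:R^-1 * f (g^-1)%g); apply/val_inj/ffunP => x.
transitivity (card_ZL%:R^-1 * \sum_(g : heis) f (g^-1)%g * delta (x * g)%g); last first.
  rewrite raddf_sum sum_ffunE mulr_sumr; apply: eq_bigr => g _.
  by rewrite !ffunE -[_ *: _]mulrA.
have -> : \sum_(g : heis) f (g^-1)%g * delta (x * g)%g =
    \sum_(g : heis | g.1 \in lag L) f x.
  rewrite (reindex_inj (mulgI (x^-1)%g)) [RHS]big_mkcond; apply: eq_bigr => g _.
  rewrite mulKVg invMg invgK; case: ifPn => gL; last by rewrite deltaE delta_out ?mulr0.
  by rewrite HfunM ?heis_fstV ?lagN // mulrAC deltaV // mul1r.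
by rewrite sumr_const -/card_ZL -[f x *+ _]mulr_natl mulrA mulVf ?card_ZL_neq0 // mul1r.
Qed.

Lemma Htrans_sep (f : Hfun Re tr L) :
  (forall g, Htrans g f 1%g = 0) -> f = 0.
Proof.
move=> f0; apply/val_inj/ffunP => x; rewrite [RHS]ffunE -(f0 x).
by rewrite ffunE mul1g.
Qed.

Definition Hfun_rank_one : rank_one (fun g => Htrans (Re := Re) (tr := tr) (L := L) g) :=
  RankOne (ev := at1) proj_delta delta1 delta_span Htrans_sep.

End Fiber.

Section Intertwiner.

Variables (L M : ELag S) (e : Hfun Re tr M).

(** An average over the group, hence an intertwiner whatever the choice of [e]. *)
Definition kernel_map (f : Hfun Re tr L) : Hfun Re tr M :=
  \sum_h f h *: Htrans (h^-1)%g e.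

Fact kernel_map_linear : linear kernel_map.
Proof.
move=> a f1 f2; rewrite scaler_sumr -big_split /=; apply: eq_bigr => h _.
by rewrite !ffunE scalerDl scalerA.
Qed.
HB.instance Definition _ :=
  GRing.isLinear.Build C (Hfun Re tr L) (Hfun Re tr M) _ kernel_map kernel_map_linear.

Lemma kernel_map_trans g f : kernel_map (Htrans g f) = Htrans g (kernel_map f).
Proof.
rewrite /kernel_map linear_sum (reindex_inj (mulIg (g^-1)%g)).
apply: eq_bigr => h _.
by rewrite linearZ /= ffunE mulgKV invMg invgK HtransM.
Qed.

End Intertwiner.

(** With [e] the translate of [delta M] by [g], the value of the image of [delta L]
    at the inverse of [g] is the sum over h of delta_L(h) delta_M(g^-1 h^-1 g).
    In the sum of these values over all [g], only the central [h] contribute, by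
    orthogonality, and they all contribute positively; so some value is
    nonzero. The pair need not be in general position. *)
Lemma kernel_map_neq0 (L M : ELag S) : exists g : heis,
  kernel_map (L := L) (Htrans g (delta M)) (delta L) != 0.
Proof.
apply: contrapT => /forallNP h0.
have {}h0 g : kernel_map (L := L) (Htrans g (delta M)) (delta L) (g^-1)%g = 0.
  by have /negP := h0 g; rewrite negbK => /eqP ->; rewrite ffunE.
have valE g : kernel_map (L := L) (Htrans g (delta M)) (delta L) (g^-1)%g =
    \sum_h delta L h * delta M (h^-1)%g * psi (om S (- h.1) g.1).
  rewrite /kernel_map -[Hval (\sum_h _)]/(val _) raddf_sum sum_ffunE.
  apply: eq_bigr => h _.
  rewrite !ffunE -!deltaE heis_conj heis_fstV Hfun_center.
  by rewrite -mulrA [delta M _ * _]mulrC.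
have orth v : \sum_(g : heis) psi (om S v g.1) =
    if v == 0 then #|{: heis}|%:R else 0.
  have [->|/om_nondeg[w /psi_nondeg[a na]]] := eqVneq v 0.
    rewrite -sum1_card natr_sum; apply: eq_bigr => g _.
    by rewrite omC om0r oppr0 psi0.
  exact: (@sum_char xpredT _ (a *: w, 0)).
have : \sum_(g : heis) kernel_map (L := L) (Htrans g (delta M)) (delta L) (g^-1)%g
    = \sum_(h : heis | h.1 == 0) #|{: heis}|%:R.
  under eq_bigr do rewrite valE.
  rewrite exchange_big [RHS]big_mkcond; apply: eq_bigr => h _ /=.
  rewrite -mulr_sumr orth oppr_eq0; case: eqP => [hz|]; last by rewrite mulr0.
  have -> : h = center S h.2 by case: h hz => v z /= ->.
  have -> : ((center S h.2)^-1)%g = center S (- h.2).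
    by apply: (mulgI (center S h.2)); rewrite mulgV heisM /= beta0l !addr0 subrr.
  by rewrite !delta_center -psiD subrr psi0 mul1r.
rewrite big1 // sumr_const -mulrnA => /esym/eqP; rewrite pnatr_eq0 muln_eq0.
rewrite !eqn0Ngt.
have -> : (0 < #|{: heis}|)%N by apply/card_gt0P; exists 1%g.
by have -> : (0 < #|[pred h : heis | h.1 == 0%R]|)%N
  by apply/card_gt0P; exists 1%g; rewrite inE.
Qed.

(** All the representations H_L are isomorphic (Stone and von Neumann). *)
Lemma intertwiner_exists (L M : ELag S) :
  exists f : {linear Hfun Re tr L -> Hfun Re tr M},
    bijective f /\ forall g u, f (Htrans g u) = Htrans g (f u).
Proof.
have [g gn0] := kernel_map_neq0 L M.
exists (kernel_map (Htrans g (delta M))); split=> [|h u]; last first.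
  exact: kernel_map_trans.
apply: (intertwiner_bij (Hfun_rank_one L) (Hfun_rank_one M)).
  by move=> h u /=; apply: kernel_map_trans.
by exists (delta L).
Qed.

End Datum.

(** * Fourth roots of unity, residues and traces *)

Section Rotation.

Variable Re : realType.

Definition quarter (m : nat) : Re[i] :=
  let t := 2 * pi / 4 * m%:R in (cos t +i* sin t)%C.

Lemma quarterD m p : quarter (m + p) = quarter m * quarter p.
Proof.
rewrite /quarter natrD mulrDr cosD sinD; apply/eqP.
by rewrite eq_complex /= eqxx [X in _ == X]addrC eqxx.
Qed.

Lemma quarter2 : quarter 2 = -1.
Proof.
rewrite /quarter; have -> : 2 * pi / 4 * 2%:R = pi :> Re by field.
by rewrite cospi sinpi; apply/eqP; rewrite eq_complex /= oppr0 !eqxx.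
Qed.

Lemma quarter0 : quarter 0 = 1.
Proof. by rewrite /quarter mulr0 cos0 sin0. Qed.

Lemma quarter_mod m : quarter (m %% 4) = quarter m.
Proof.
rewrite [in RHS](divn_eq m 4) quarterD; elim: (m %/ 4)%N => [|q IHq].
  by rewrite mul0n quarter0 mul1r.
by rewrite mulSn quarterD -mulrA -IHq (quarterD 2 2) quarter2 mulrNN !mul1r.
Qed.

End Rotation.

Section LinearizedPolynomial.

(** A nonzero sum of the v_j X^(2^j), j < d, has at most 2^(d-1) roots. *)
Lemma linearized_eq0 (k : finFieldType) d (v : 'I_d -> k) :
  (2 ^ d <= #|k|)%N -> (forall x, \sum_j v j * x ^+ (2 ^ j) = 0) ->
  forall j, v j = 0.
Proof.
move=> dk v0 j0; pose q : {poly k} := \sum_j v j *: 'X^(2 ^ j).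
have q0 : q = 0.
  apply/eqP; apply: contraLR dk => qn0; rewrite -ltnNge.
  have qroots : all (root q) (enum k).
    apply/allP => x _; rewrite /root horner_sum; apply/eqP.
    by rewrite -[RHS](v0 x); apply: eq_bigr => j _; rewrite hornerZ hornerXn.
  rewrite cardE; apply: leq_trans (max_poly_roots qn0 qroots (enum_uniq _)) _.
  apply: leq_trans (size_sum _ _ _) _; apply/bigmax_leqP => j _.
  by apply: leq_trans (size_scale_leq _ _) _; rewrite size_polyXn ltn_exp2l.
have := congr1 (fun p : {poly k} => p`_(2 ^ j0)) q0; rewrite coef0 coef_sum.
rewrite (bigD1 j0) //= coefZ coefXn eqxx mulr1 big1 ?addr0 // => j jj0.
by rewrite coefZ coefXn eqn_exp2l // eq_sym (negPf (_ : val j != val j0)) ?mulr0.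
Qed.

End LinearizedPolynomial.

Import VectorInternalTheory.

Section Residues.

Variables (A : comNzRingType) (k : finFieldType) (R : finComNzRingType).
Variables (redk : {rmorphism A -> k}) (redR : {rmorphism A -> R}).
Hypothesis hk : is_quotient 2%:R redk.
Hypothesis hR : is_quotient (2%:R ^+ 2) redR.

Lemma R_mulr4 (x : R) : x *+ 4 = 0.
Proof.
rewrite -mulr_natl -(rmorph_nat redR) (_ : redR _ = 0) ?mul0r //.
by apply/(proj2 hR); exists 1; rewrite mulr1 -natrX.
Qed.

Lemma k_mulr2 (x : k) : x *+ 2 = 0.
Proof.
rewrite -mulr_natl -(rmorph_nat redk) (_ : redk _ = 0) ?mul0r //.
by apply/(proj2 hk); exists 1; rewrite mulr1.
Qed.

(** 4 is a multiple of 2, so that the reduction modulo 2 factors through R. *)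
Lemma residue_map : exists rho : {rmorphism R -> k},
  (forall x, exists y, rho y = x) /\
  (forall y, rho y = 0 -> exists z, y = z *+ 2).
Proof.
have [s sE] := choice (proj1 hR).
have red_eq a b : redR a = redR b -> redk a = redk b.
  move/eqP; rewrite -subr_eq0 -rmorphB => /eqP/(proj2 hR)[y yE].
  apply/eqP; rewrite -subr_eq0 -rmorphB yE rmorphM rmorphXn rmorph_nat.
  by rewrite -[2%:R]/(1 *+ 2) k_mulr2 expr0n mul0r.
pose rho r := redk (s r).
have rhoE a : rho (redR a) = redk a by apply: red_eq; rewrite sE.
have rhoB : zmod_morphism rho.
  by move=> x y; rewrite -(sE x) -(sE y) -rmorphB !rhoE rmorphB.
have rhoM : monoid_morphism rho.
  split=> [|x y]; first by rewrite -(rmorph1 redR) rhoE rmorph1.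
  by rewrite -(sE x) -(sE y) -rmorphM !rhoE rmorphM.
exists (HB.pack_for {rmorphism R -> k} rho
  (GRing.isZmodMorphism.Build R k rho rhoB)
  (GRing.isMonoidMorphism.Build R k rho rhoM)); split=> [x|y] /=.
  by have [a <-] := proj1 hk x; exists (redR a); rewrite rhoE.
rewrite -(sE y) rhoE => /(proj2 hk)[z ->].
by exists (redR z); rewrite rmorphM rmorph_nat mulr_natl.
Qed.

Variables (d : nat) (tr : R -> 'Z_4).
Hypothesis htr : is_trace d tr.

Lemma mulr_mod4 (x : R) m : x *+ (m %% 4) = x *+ m.
Proof. by rewrite [in RHS](divn_eq m 4) mulrnDr mulnC mulrnA R_mulr4 mul0rn add0r. Qed.

Section Basis.

Variable b : 'I_d -> R.
Definition comb (c : 'rV['Z_4]_d) : R := \sum_i b i *+ c 0 i.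

Lemma combD c1 c2 : comb (c1 + c2) = comb c1 + comb c2.
Proof.
by rewrite -big_split; apply: eq_bigr => i _; rewrite mxE mulr_mod4 mulrnDr.
Qed.

Lemma comb0 : comb 0 = 0.
Proof. by rewrite /comb big1 // => i _; rewrite mxE. Qed.

End Basis.

(** The matrix of a multiplication is unique, since R is free over Z/4. *)
Lemma trD x y : tr (x + y) = tr x + tr y.
Proof.
have [b /bij_inj b_inj trE] := htr.
have [X XE ->] := trE x; have [Y YE ->] := trE y; have [Z ZE ->] := trE (x + y).
rewrite -mxtraceD; congr (\tr _); apply/row_matrixP => i; apply: b_inj.
have rowE (M : 'M['Z_4]_d) : \sum_j b j *+ M i j = comb b (row i M).
  by apply: eq_bigr => j _; rewrite mxE.
have := ZE i; rewrite mulrDl XE YE !rowE -combD -raddfD.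
by move=> /esym.
Qed.

Lemma divisible_by_2 (y : R) : y *+ 2 = 0 -> exists z, y = z *+ 2.
Proof.
have [b [c cK Kc] _] := htr => y2.
have dbl z : comb b (c z + c z) = z *+ 2 by rewrite combD [comb b _]Kc mulr2n.
have : c y + c y = 0.
  by rewrite -[LHS]cK -[RHS]cK; congr c; rewrite [LHS]dbl y2 [RHS]comb0.
move=> cy; exists (comb b (\row_i inord ((c y 0 i)./2))).
rewrite -[LHS]Kc mulr2n -combD; congr (comb b _); apply/rowP => i.
have := congr1 (fun M : 'rV_d => M 0 i) cy; rewrite !mxE.
move: (c y 0 i) => {cy} x xx; apply/val_inj.
have /= -> : val (inord x./2 + inord x./2 : 'Z_4) = ((x./2 + x./2) %% 4)%N.
  by rewrite /= !inordK //; case: x xx => [[|[|[|[|]]]]].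
by move/(congr1 val): xx; case: x => [[|[|[|[|]]]]].
Qed.

Lemma odd_Z4D (x y : 'Z_4) : odd (x + y)%R = odd x (+) odd y.
Proof. by case: x y => [[|[|[|[|]]]]] // ? [[|[|[|[|]]]]]. Qed.

(** The reductions of a basis of R over Z/4 are linearly independent over F_2. *)
Lemma card_residue : (2 ^ d <= #|k|)%N.
Proof.
have [b [c cK Kc] _] := htr; have [rho [_ rho_ker]] := residue_map.
pose lift (f : {ffun 'I_d -> bool}) : 'rV['Z_4]_d := \row_i (f i : nat)%:R.
suff inj : injective (fun f => rho (comb b (lift f))).
  by have := leq_card _ inj; rewrite card_ffun card_bool card_ord.
move=> f g /eqP; rewrite -subr_eq0 -rmorphB => /eqP/rho_ker[z zE].
have liftE : lift f = lift g + (c z + c z).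
  rewrite -[LHS]cK -[RHS]cK; congr c; rewrite [RHS]combD combD [comb b (c z)]Kc.
  by rewrite -mulr2n -zE addrC subrK.
apply/ffunP => i; have := congr1 (fun M : 'rV['Z_4]_d => odd (M 0 i)) liftE.
rewrite !mxE !odd_Z4D addbb addbF.
by case: (f i) (g i) => [] [].
Qed.

(** Some trace is odd, because the extension k / F_2 is separable. The matrix
    [P] of the conjugates of the reduced basis is invertible; it diagonalizes the
    multiplication by any [r], with the conjugates of the residue of [r] as
    eigenvalues. So the residue of [tr r] is the sum of these conjugates,
    a polynomial function of degree 2^(d-1) which cannot vanish on the whole of k. *)
Lemma trace_odd : exists r, odd (tr r).
Proof.
have [b [c cK Kc] trE] := htr; have [rho [rho_surj _]] := residue_map.
have k2 : 2%N \in [pchar k] by rewrite inE /= -[2%:R]/(1 *+ 2) k_mulr2 eqxx.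
(* The reduction of Z/4 modulo 2, in the prime subfield of k. *)
pose e (x : 'Z_4) : k := (odd x)%:R.
have eD : {morph e : x y / x + y}.
  move=> x y; rewrite /e odd_Z4D; case: (odd x) (odd y) => [] [];
  by rewrite /= ?addr0 ?add0r // -mulr2n k_mulr2.
have rho_comb x : rho (comb b x) = \sum_i rho (b i) * e (x 0 i).
  rewrite rmorph_sum; apply: eq_bigr => i _; rewrite rmorphMn /= -mulr_natr.
  congr (_ * _); rewrite /e -[in LHS](odd_double_half (x 0 i)) -mul2n.
  by rewrite natrD natrM -[2%:R]/(1 *+ 2) k_mulr2 mul0r addr0.
have d_gt0 : (0 < d)%N.
  rewrite lt0n; apply/eqP => d0; have := oner_neq0 R; case/eqP.
  by rewrite -[1]Kc big1 // => i _; have := ltn_ord i; rewrite [X in (_ < X)%N]d0.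
have powD j : {morph (fun x : k => x ^+ (2 ^ j)) : x y / x + y}.
  by move=> x y /=; apply: exprDn_pchar; rewrite pnatX (pnatE _ (isT : prime 2)) k2.
have pow0 j : 0 ^+ (2 ^ j) = 0 :> k by rewrite expr0n expn_eq0.
have powe j x : e x ^+ (2 ^ j) = e x.
  by rewrite /e; case: odd; rewrite ?expr1n ?pow0.
have pow_comb j x : rho (comb b x) ^+ (2 ^ j) =
    \sum_i rho (b i) ^+ (2 ^ j) * e (x 0 i).
  rewrite rho_comb (big_morph _ (powD j) (pow0 j)).
  by apply: eq_bigr => i _; rewrite exprMn powe.
pose P := \matrix_(i < d, j < d) rho (b i) ^+ (2 ^ j).
have P_unit : P \in unitmx.
  rewrite unitmxE unitfE -det_tr; apply/negP => /det0P[v vn0 vP].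
  case/eqP: vn0; apply/rowP => j; rewrite mxE; move: j.
  apply: (linearized_eq0 card_residue) => x.
  have [y <-] := rho_surj x; rewrite -[y]Kc.
  under eq_bigr do rewrite [rho _ ^+ _]pow_comb mulr_sumr.
  rewrite exchange_big big1 // => i _ /=.
  have := congr1 (fun M : 'rV_d => M 0 i) vP; rewrite !mxE => vPi.
  transitivity ((\sum_j v 0 j * P^T j i) * e (c y 0 i)); last by rewrite vPi mul0r.
  by rewrite mulr_suml; apply: eq_bigr => j _; rewrite mxE [P i j]mxE mulrA.
have tr_conj r : e (tr r) = \sum_(j < d) rho r ^+ (2 ^ j).
  have [X XE ->] := trE r.
  pose D := diag_mx (\row_(j < d) rho r ^+ (2 ^ j)).
  have XP : map_mx e X *m P = P *m D.
    apply/matrixP => i j; rewrite mul_mx_diag !mxE -exprMn -rmorphM mulrC XE.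
    have -> : \sum_j b j *+ X i j = comb b (row i X).
      by apply: eq_bigr => l _; rewrite mxE.
    by rewrite pow_comb; apply: eq_bigr => l _; rewrite !mxE mulrC.
  transitivity (\tr (map_mx e X)).
    rewrite /mxtrace (big_morph e eD (erefl _ : e 0 = 0)).
    by apply: eq_bigr => i _; rewrite mxE.
  rewrite -[map_mx e X](mulmxK P_unit) XP mxtrace_mulC mulKmx // mxtrace_diag.
  by apply: eq_bigr => j _; rewrite mxE.
apply: contrapT => /forallNP even_tr.
suff h : (1 : k) = 0 by have := oner_neq0 k; rewrite h eqxx.
apply: (@linearized_eq0 k d (fun=> 1) card_residue _ (Ordinal d_gt0)) => x.
have [y <-] := rho_surj x; under eq_bigr do rewrite mul1r.
by rewrite -tr_conj /e (negPf (introN idP (even_tr y))).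
Qed.

Variable Re : realType.
Local Notation psi := (psi Re tr).

Lemma psiE z : psi z = quarter Re (tr z).
Proof. by []. Qed.

Lemma tr0 : tr 0 = 0.
Proof. by apply: (addrI (tr 0)); rewrite -trD !addr0. Qed.

Lemma psi_0 : psi 0 = 1.
Proof. by rewrite psiE tr0 quarter0. Qed.

Lemma psi_D z1 z2 : psi (z1 + z2) = psi z1 * psi z2.
Proof. by rewrite !psiE trD -quarterD -(quarter_mod _ (tr z1 + tr z2)). Qed.

(** A nonzero 2x has x invertible modulo 2; so some multiple of 2x is 2r with
    [tr r] odd, where psi takes the value -1. *)
Lemma psi_multiple (x : R) : x *+ 2 != 0 -> exists a : A, psi (redR a * (x *+ 2)) != 1.
Proof.
move=> x2; have [rho [rho_surj rho_ker]] := residue_map.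
have rx : rho x != 0.
  by apply: contraNN x2 => /eqP/rho_ker[z ->]; rewrite -mulrnA R_mulr4.
have [r tr_r] := trace_odd; have [s sE] := rho_surj (rho r / rho x).
have [u uE] : exists u, s * x = r + u *+ 2.
  have [|u uE] := rho_ker (s * x - r); last by exists u; rewrite -uE addrC subrK.
  by rewrite rmorphB rmorphM sE mulfVK // subrr.
have [a aE] := proj1 hR s; exists a; rewrite aE mulrnAr uE mulrnDl -mulrnA R_mulr4.
rewrite addr0 mulr2n psi_D psiE -quarterD.
have -> : quarter Re (tr r + tr r) = -1.
  rewrite -quarter_mod -(quarter2 Re); congr (quarter Re _).
  by case: (tr r) tr_r => [[|[|[|[|]]]]].
by rewrite eq_sym -subr_eq0 opprK -(natrD _ 1 1) pnatr_eq0.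
Qed.

Variables (n : nat) (S : symplectic_datum redk redR n).

Lemma psi_om_nondeg (v w : V S) : om S v w != 0 ->
  exists a : k, psi (om S v (a *: w)) != 1.
Proof.
have [vt vtE] := redV_surj v; have [wt wtE] := redV_surj w.
have omE2 : om S v w = omt S vt wt *+ 2 by rewrite -vtE -wtE omE.
by rewrite omE2 => /psi_multiple[a na]; exists (redk a); rewrite omZ omE2.
Qed.

Lemma Vt_divisible_by_2 (v : Vt S) : v *+ 2 = 0 -> exists w, v = w *+ 2.
Proof.
move=> v2; have dv i : exists z, v2r v 0 i = z *+ 2.
  apply: divisible_by_2; have := congr1 (fun u => v2r u 0 i) v2.
  by rewrite linear0 linearMn !mxE.
have [z zE] := choice dv; exists (r2v (\row_i z i)).
apply: (can_inj v2rK); rewrite linearMn /= r2vK; apply/rowP => i.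
by rewrite mulmxnE mxE.
Qed.

(** If om(v, .) vanishes, then so does omt(2v, .) upstairs; so 2v = 0, and v is
    divisible by 2 since R is free over Z/4. *)
Lemma om_nondegenerate (v : V S) : v != 0 -> exists w, om S v w != 0.
Proof.
move=> vn0; apply: contrapT => /forallNP h; case/eqP: vn0.
have [vt vtE] := redV_surj v; rewrite -vtE; apply/redV_ker.
apply: Vt_divisible_by_2; have [_ _ _ om_nd] := omtP S; apply: om_nd => w.
have om0 : omt S vt w *+ 2 = 0.
  by apply/eqP; have /negP := h (redV S w); rewrite negbK -vtE omE.
by rewrite mulr2n omtDl -mulr2n.
Qed.

(** The image of the Lagrangian L0, with the section l |-> (l, 0): the cocycle beta
    vanishes on it. A vector l + m orthogonal to L0 modulo 2 has 2m in both
    L0 and M0, so 2m = 0 and m reduces to 0. *)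
Lemma ELag_exists : inhabited (ELag S).
Proof.
pose lg : {set V S} := [set v | `[< exists2 l, l \in L0 S & v = redV S l >]].
have lgP v : reflect (exists2 l, l \in L0 S & v = redV S l) (v \in lg).
  by rewrite inE; apply: asboolP.
have [[L00 L0Z] _ L0L] := L0P S; have [[M00 _] _ M0L] := M0P S.
have lg_sub : submod_closed lg.
  split=> [|a _ _ /lgP[x xL ->] /lgP[y yL ->]].
    by apply/lgP; exists 0; rewrite ?raddf0.
  have [a' <-] := proj1 hk a; apply/lgP; exists (redR a' *: x + y).
    exact: L0Z.
  by rewrite raddfD redV_scale.
have lg_lag : lagrangian (om S) (mem lg).
  move=> v; split=> [/lgP[x xL ->] _ /lgP[y yL ->]|vlg].
    by rewrite omE (proj1 (L0L x) xL y yL) mul0rn.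
  have [vt vtE] := redV_surj v; have [l [m [lL mM vlm]]] := Defs.splitP vt.
  have m2 : m *+ 2 = 0.
    have m2M : m *+ 2 \in M0 S by rewrite mulr2n M0D.
    have m2L : m *+ 2 \in L0 S.
      apply/L0L => w wL; have := vlg (redV S w) => /(_ _).
      have -> : (redV S w \in mem lg) by apply/lgP; exists w.
      move=> /(_ isT); rewrite -vtE vlm omE.
      by rewrite omtDl (proj1 (L0L l) lL w wL) add0r [m *+ 2]mulr2n omtDl -mulr2n.
    have [p [_ uniq_p]] := splitting (m *+ 2).
    have := uniq_p (m *+ 2, 0) _; have := uniq_p (0, m *+ 2) _.
    rewrite /= add0r addr0 => h1 h2.
    have : (0, m *+ 2) = (m *+ 2, 0) :> _ * _ by rewrite -h1 // -h2.
    by case.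
  have [u uE] := Vt_divisible_by_2 m2.
  have m0 : redV S m = 0 by apply/redV_ker; exists u.
  by apply/lgP; exists l => //; rewrite -vtE vlm raddfD m0 addr0.
pose sc (l : {v | v \in lg}) : heis S := (val l, 0).
have scM (l1 l2 l3 : {v | v \in lg}) : val l3 = val l1 + val l2 ->
    sc l3 = (sc l1 * sc l2)%g.
  move=> l3E; rewrite heisM /= !add0r /sc l3E; congr (_, _).
  have /lgP[x xL ->] := valP l1; have /lgP[y yL ->] := valP l2.
  rewrite betaE -[x]addr0 -[y]addr0 betatE //.
  by rewrite omt0r mul0rn.
exact: (inhabits (MkELag (conj lg_sub lg_lag) (sec := sc) (fun=> erefl) scM)).
Qed.

End Residues.

(** * The Weil gerbe *)

Section Gerbe.

Variables (A : comNzRingType) (k : finFieldType) (R : finComNzRingType).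
Variables (redk : {rmorphism A -> k}) (redR : {rmorphism A -> R}) (n : nat).
Variable S : symplectic_datum redk redR n.
Variables (Re : realType) (tr : R -> 'Z_4).
Local Notation C := Re[i].
Local Notation Hfun := (Hfun Re tr (S := S)).
Local Notation heis := (heis S).
Local Notation Htrans := (Htrans (Re := Re) (tr := tr) (S := S)).

Hypothesis rank_oneH : forall L, rank_one (fun g : heis => Htrans (L := L) g).
Hypothesis intertwinerH : forall L M, exists f : {linear Hfun L -> Hfun M},
  bijective f /\ forall g u, f (Htrans g u) = Htrans g (f u).

Variable T : trivialization (tens_bundle 4 (Hbundle S Re tr)).

Lemma triv_idE L x : T L L x = x.
Proof. by apply: (bij_inj (triv_bij T L L)); rewrite triv_comp. Qed.

(** With F an isomorphism from H_L to H_M, the operator T_(M,L) followed by the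
    inverse of the fourth tensor power of F commutes with the four copies of H(V); so
    it is a scalar a, and a fourth root of a is absorbed into F. *)
Lemma triv_fourth_root M L : exists f : {linear Hfun L -> Hfun M},
  [/\ bijective f, forall g u, f (Htrans g u) = Htrans g (f u) &
      forall t, T M L t = tmap (fun=> f) t].
Proof.
have [F [F_bij F_tr]] := intertwinerH L M.
have [G [FK GK]] := linear_inverse F_bij.
have G_tr g u : G (Htrans g u) = Htrans g (G u).
  by apply: (can_inj FK); rewrite F_tr !GK.
pose GT : {linear tens 4 (Hfun L) -> tens 4 (Hfun L)} :=
  tmap (fun=> G) \o T M L.
have [|a aE] := tens_intertwiner_scalar (rank_oneH L) (f := GT).
  move=> g t; have /= -> := @triv_act _ _ _ _ _ _ _ _ _ _ T M L g t.
  rewrite (tmap_tmap (h := fun i => G \o Htrans (g i))) //.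
  by rewrite (tmap_tmap (h := fun i => G \o Htrans (g i))) // => i u /=.
have TE t : T M L t = a *: tmap (fun=> F) t.
  by rewrite -linearZ -aE /= tmap_cancel.
have an0 : a != 0.
  apply/eqP => a0; case/eqP: (ptens_gen_neq0 (rank_oneH L) 4).
  by apply: (bij_inj (triv_bij T M L)); rewrite linear0 TE a0 scale0r.
pose c : C := 4.-root a.
have cE : c ^+ 4 = a by rewrite rootCK.
have cn0 : c != 0 by apply: contraNN an0 => /eqP c0; rewrite -cE c0 expr0n.
exists (homothety c \o F); split.
- exists (G \o homothety c^-1) => u /=; rewrite /homothety.
    by rewrite scalerA mulVf // scale1r FK.
  by rewrite GK scalerA mulfV // scale1r.
- by move=> g u /=; rewrite /homothety F_tr linearZ.
move=> t; rewrite (tmap_comp (f := fun=> F) (g := fun=> homothety c)) //=.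
by rewrite (tmap_scale (a := c)) // cE TE.
Qed.

Section ConstantBundle.

Variable B : ELag S.

Definition constant_bundle : bundle S Re 1 :=
  @Bundle _ _ _ _ _ _ S Re 1 (fun=> Hfun B) (fun L g => Htrans (L := B) (g ord0))
    (fun _ => @Htrans1 _ _ _ _ _ _ S Re tr B)
    (fun _ g1 g2 => @HtransM _ _ _ _ _ _ S Re tr B (g1 ord0) (g2 ord0)).

Fact constant_triv_bij (M L : ELag S) : bijective (@idfun (Hfun B)).
Proof. by exists idfun. Qed.
Definition constant_triv : trivialization constant_bundle :=
  @Trivialization _ _ _ _ _ _ S Re 1 constant_bundle (fun M L => idfun)
    constant_triv_bij (fun _ _ _ _ => erefl) (fun _ _ _ _ => erefl).

End ConstantBundle.

(** The constant bundle with fiber H_B and its identity trivialization, identified with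
    the bundle of the H_L by fourth roots of the T_(L,B): no cocycle condition has
    to be arranged. *)
Lemma Wobj_exists (B : ELag S) : inhabited (W T).
Proof.
pose f L := projT1 (cid (triv_fourth_root L B)).
have fP L : [/\ bijective (f L), forall g u, f L (Htrans g u) = Htrans g (f L u) &
    forall t, T L B t = tmap (fun=> f L) t].
  exact: (projT2 (cid (triv_fourth_root L B))).
have f_bij L : bijective (f L) by have [] := fP L.
have f_act (L : ELag S) (g : 'I_1 -> heis) u :
    f L (Htrans (g ord0) u) = Htrans (g ord0) (f L u) by have [_ ->] := fP L.
pose phi : bundle_iso (constant_bundle B) (Hbundle S Re tr) :=
  @BundleIso _ _ _ _ _ _ S Re 1 (constant_bundle B) (Hbundle S Re tr) f f_bij f_act.
suff phiP M L t : tmap (m := 4) (fun=> phi M) (tmap (fun=> constant_triv B M L) t) =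
    T M L (tmap (fun=> phi L) t).
  exact: (inhabits (MkWobj phiP)).
have [_ _ fM] := fP M; have [_ _ fL] := fP L.
by rewrite [tmap (fun=> constant_triv B M L) t]tmap_id // -fM -fL triv_comp.
Qed.

Lemma Wphi_inverse (E : Wobj T) L : exists g : {linear Hfun L -> E L},
  [/\ cancel (Wphi E L) g, cancel g (Wphi E L) &
      forall (h : 'I_1 -> heis) u, g (Htrans (h ord0) u) = Defs.act E L h (g u)].
Proof.
have [g [gK Kg]] := linear_inverse (biso_bij (Wphi E) L).
exists g; split=> // h u; apply: (can_inj gK).
by rewrite Kg (biso_act (Wphi E)) Kg.
Qed.

(** Schur's lemma. The fourth power of the scalar is the one by which [f] acts on
    the fourth tensor powers, once these are identified by [Wphi], and there [f] is
    the identity. *)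
Lemma Whom_scalar (E1 E2 : Wobj T) (f : Whom E1 E2) L : exists c : C,
  c ^+ 4 = 1 /\ forall x, Wphi E2 L (f L x) = c *: Wphi E1 L x.
Proof.
have [g [gK Kg g_act]] := Wphi_inverse E1 L.
have [|c cE] := intertwiner_scalar (rank_oneH L) (f := Wphi E2 L \o f L \o g).
  move=> h u /=; rewrite (g_act (fun=> h)) Wmap_act.
  exact: (biso_act (Wphi E2)).
exists c; have fE x : Wphi E2 L (f L x) = c *: Wphi E1 L x by rewrite -cE /= gK.
split=> //; set e := ptens (fun=> gen (rank_oneH L)) : tens 4 _.
have en0 : e != 0 by apply: ptens_gen_neq0.
pose t := tmap (fun=> g) e.
have te : tmap (fun=> Wphi E1 L) t = e.
  by rewrite /t tmap_cancel.
have := Wmap_phi f (L := L) t; rewrite te.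
rewrite (tmap_tmap (h := fun=> homothety c \o Wphi E1 L)) //.
rewrite (tmap_comp (f := fun=> Wphi E1 L) (g := fun=> homothety c)) //= te.
rewrite (tmap_scale (a := c)) // => /eqP; rewrite -subr_eq0 -{2}[e]scale1r.
by rewrite -scalerBl scaler_eq0 (negPf en0) orbF subr_eq0 => /eqP.
Qed.

Lemma Whom_bij (E1 E2 : Wobj T) (f : Whom E1 E2) L : bijective (f L).
Proof.
have [c [c4 fE]] := Whom_scalar f L.
have cn0 : c != 0 by apply/eqP => c0; move/eqP: c4; rewrite c0 expr0n eq_sym oner_eq0.
have [g [gK Kg _]] := Wphi_inverse E1 L.
have [g2 [g2K Kg2 _]] := Wphi_inverse E2 L.
exists (fun y => c^-1 *: g (Wphi E2 L y)) => x.
  by rewrite fE linearZ /= gK scalerA mulVf // scale1r.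
apply: (can_inj g2K); rewrite linearZ linearZ /= fE Kg.
by rewrite scalerA mulVf // scale1r.
Qed.

Lemma W_groupoid : groupoid (W T).
Proof.
move=> E1 E2 f.
pose g L := projT1 (cid (linear_inverse (Whom_bij f L))).
have gP L : cancel (f L) (g L) /\ cancel (g L) (f L).
  exact: (projT2 (cid (linear_inverse (Whom_bij f L)))).
have fK L : cancel (f L) (g L) by have [] := gP L.
have gK L : cancel (g L) (f L) by have [] := gP L.
have g_act L h x : g L (Defs.act E2 L h x) = Defs.act E1 L h (g L x).
  by apply: (can_inj (fK L)); rewrite Wmap_act !gK.
have g_triv M L x : g M (Wtriv E2 M L x) = Wtriv E1 M L (g L x).
  by apply: (can_inj (fK M)); rewrite Wmap_triv !gK.
have g_phi L t : tmap (m := 4) (fun=> Wphi E1 L) (tmap (fun=> g L) t) =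
    tmap (fun=> Wphi E2 L) t.
  by rewrite -(Wmap_phi f) tmap_cancel.
exists (MkWhom g_act g_triv g_phi); split; apply: Whom_ext => L x /=.
  exact: fK.
exact: gK.
Qed.

(** An isomorphism of the fibers over [B] is transported by the two trivializations;
    it respects the fourth tensor powers elsewhere because both of these
    trivializations have the same fourth power [T]. *)
Lemma Whom_exists (B : ELag S) (E1 E2 : Wobj T) : inhabited (Whom E1 E2).
Proof.
have [g [gK Kg g_act]] := Wphi_inverse E2 B.
pose f L : {linear E1 L -> E2 L} :=
  Wtriv E2 L B \o (g \o (Wphi E1 B \o Wtriv E1 B L)).
have f_act L h x : f L (Defs.act E1 L h x) = Defs.act E2 L h (f L x).
  rewrite /= (triv_act (Wtriv E1)) (biso_act (Wphi E1)) /=.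
  by rewrite g_act (triv_act (Wtriv E2)).
have f_triv M L x : f M (Wtriv E1 M L x) = Wtriv E2 M L (f L x).
  by rewrite /= !triv_comp.
have f_phi L t : tmap (m := 4) (fun=> Wphi E2 L) (tmap (fun=> f L) t) =
    tmap (fun=> Wphi E1 L) t.
  rewrite (tmap_comp (f := fun=> g \o (Wphi E1 B \o Wtriv E1 B L))
    (g := fun=> Wtriv E2 L B)) //= WphiP.
  rewrite (tmap_comp (f := fun=> Wphi E1 B \o Wtriv E1 B L) (g := fun=> g)) //=.
  rewrite [tmap _ (tmap (fun=> g) _)]tmap_cancel //.
  rewrite (tmap_comp (f := fun=> Wtriv E1 B L) (g := fun=> Wphi E1 B)) //= WphiP.
  by rewrite triv_comp triv_idE.
exact: (inhabits (MkWhom f_act f_triv f_phi)).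
Qed.

Lemma W_end_mu (B : ELag S) (E : Wobj T) : end_is_mu C 4 (E : W T).
Proof.
have [g [gK Kg _]] := Wphi_inverse E B.
have scal (f : Whom E E) : exists c : C, forall x, f B x = c *: x.
  have [c [_ fE]] := Whom_scalar f B; exists c => x.
  by apply: (can_inj gK); rewrite fE linearZ.
pose chi (f : Whom E E) : C := projT1 (cid (scal f)).
have chiP (f : Whom E E) x : f B x = chi f *: x.
  exact: (projT2 (cid (scal f))).
pose e := g (gen (rank_oneH B)).
have en0 : e != 0.
  by apply: contraNN (gen_neq0 (rank_oneH B)) => /eqP e0; rewrite -[gen _]Kg -/e e0 linear0.
have scal_inj (a b : C) : a *: e = b *: e -> a = b.
  move/eqP; rewrite -subr_eq0 -scalerBl scaler_eq0 (negPf en0) orbF subr_eq0.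
  by move/eqP.
exists chi; split.
- move=> f1 f2 chi12; apply: Whom_ext => L x.
  (* The trivialization carries the scalar from the fiber at [B] to all others. *)
  have -> : x = Wtriv E L B (Wtriv E B L x).
    by apply: (bij_inj (triv_bij (Wtriv E) B L)); rewrite !triv_comp.
  by move: (Wtriv E B L x) => y; rewrite !Wmap_triv !chiP chi12.
- by move=> f1 f2; apply: scal_inj; rewrite -scalerA -!chiP.
move=> z; rewrite unity_rootE; split=> [/eqP z4|[f <-]]; last first.
  have [c [c4 fE]] := Whom_scalar f B; suff -> : chi f = c by rewrite c4.
  by apply: scal_inj; rewrite -chiP; apply: (can_inj gK); rewrite fE linearZ.
have z_phi L t : tmap (m := 4) (fun=> Wphi E L) (tmap (fun=> @homothety _ (E L) z) t) =
    tmap (fun=> Wphi E L) t.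
  by rewrite (tmap_scale (a := z)) // z4 scale1r.
have z_act L h (x : E L) : homothety z (Defs.act E L h x) = Defs.act E L h (homothety z x).
  by rewrite /homothety linearZ.
have z_triv M L (x : E L) : homothety z (Wtriv E M L x) = Wtriv E M L (homothety z x).
  by rewrite /homothety linearZ.
exists (@MkWhom _ _ _ _ _ _ _ _ _ T E E (fun L => @homothety _ (E L) z)
  z_act z_triv z_phi).
by apply: scal_inj; rewrite -chiP.
Qed.

End Gerbe.

Theorem proposition3p7 (Re : realType) (d n : nat)
  (K : fieldExtType Q2) (hd : \dim {: K} = d) (hK : unramified K)
  (k : finFieldType) (redk : {rmorphism OK K -> k})
  (hk : is_quotient 2%:R redk)
  (R : finComNzRingType) (redR : {rmorphism OK K -> R})
  (hR : is_quotient (2%:R ^+ 2) redR)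
  (tr : R -> 'Z_4) (htr : is_trace d tr)
  (S : symplectic_datum redk redR n)
  (T : trivialization (tens_bundle 4 (Hbundle S Re tr)))
  (hT : canonical_trivialization d T) :
  gerbe (W T) /\ forall E : W T, end_is_mu Re[i] 4 E.
Proof.
have psi0 := psi_0 hR htr Re; have psiD := psi_D hR htr Re.
have psi_nd := psi_om_nondeg hk hR htr Re (S := S).
have om_nd := om_nondegenerate hR htr (S := S).
have rk L := Hfun_rank_one psi0 psiD psi_nd L.
have int := intertwiner_exists psi0 psiD psi_nd om_nd.
have [B] := ELag_exists hk hR htr S.
split=> [|E]; last exact: (W_end_mu rk B E).
have grp := W_groupoid rk (T := T).
split=> //; first exact: (Wobj_exists rk int T B).
by move=> E1 E2; have [f] := Whom_exists B E1 E2; exists f; apply: grp.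
Qed.
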